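(* Let $H$ be a real Hilbert space with $\dim H\ge2$, let $\mathbb B_H=\{x\in H:|x|<1\}$, and fix an orthonormal pair $e_1,e_2\in H$. For $0<\tau\le1$ define $D_\tau(t)=\sqrt{\cos^2t+\tau^2\sin^2t}$ and $$\Phi_\tau(e^{it})=\frac{\cos t\,e_1+\tau\sin t\,e_2}{D_\tau(t)} .$$ Let $F_\tau=P[\Phi_\tau]$. Then $F_\tau:\mathbb D\to\mathbb B_H$ is harmonic, $F_\tau(0)=0$, and $F_{\tau,x}(0)=\alpha(\tau)e_1$, $F_{\tau,y}(0)=\beta(\tau)e_2$, where $$\alpha(\tau)=\frac1\pi\int_0^{2\pi}\frac{\cos^2t}{D_\tau(t)}\,dt,\qquad \beta(\tau)=\frac1\pi\int_0^{2\pi}\frac{\tau\sin^2t}{D_\tau(t)}\,dt .$$ Both quantities are positive, and $\alpha(\tau)\ge\beta(\tau)$. For $K\ge1$, let $M_K$ denote the supremum of $L_F(0)$ over all harmonic maps $F:\mathbb D\to\mathbb B_H$ with $F(0)=0$ that are $K$-quasiconformal at the origin in the pointwise sense. Then $$M_K=\inf_{0<\tau\le1}\frac{2J(\tau)}{1+\tau/K},\qquad J(\tau)=\int_{\mathbb T}D_\tau(t)\,dm .$$ For $K=1$, the unique minimizing parameter is $\tau_1=1$. For every $K>1$, there is a unique minimizer $\tau_K\in(0,1)$, characterized by $$\frac{\alpha(\tau_K)}{\beta(\tau_K)}=K .$$ Moreover, $M_K=\alpha(\tau_K)$, and $F_{\tau_K}$ attains the bound. For a harmonic map $F:\mathbb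 D\to\mathbb B_H$ with $F(0)=0$ that is $K$-quasiconformal at the origin in the pointwise sense, equality $L_F(0)=M_K$ holds if and only if $F$ has the form $\mathcal U\circ F_{\tau_K}\circ\mathcal R$, where $\mathcal U:H\to H$ is an orthogonal transformation and $\mathcal R$ is a rotation or reflection of $\mathbb D$.
   Context: $\mathbb D$ is the open unit disk in $\mathbb C$, $\mathbb T=\partial\mathbb D$, $m$ is normalized Lebesgue measure on $\mathbb T$ ($dm=dt/2\pi$). A $C^2$ map $F:\mathbb D\to H$ is harmonic if $\Delta F=0$. $P[\Phi](re^{i\theta})=\int_{\mathbb T}\frac{1-r^2}{1-2r\cos(\theta-t)+r^2}\Phi(e^{it})\,dm$ is the (Bochner) Poisson integral. $L_F(0)=\max_{|v|=1}|dF_0v|$ and $\ell_F(0)=\min_{|v|=1}|dF_0v|$; $F$ is $K$-quasiconformal at the origin in the pointwise sense if $0<\ell_F(0)\le L_F(0)\le K\ell_F(0)$. An orthogonal transformation of $H$ is a surjective linear isometry; rotations and reflections of $\mathbb D$ are restrictions of elements of $O(2)$. *)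

(* Defs.v *)
From Stdlib Require Import Reals.
From Coquelicot Require Import Coquelicot.

Open Scope R_scope.

(** * Real Hilbert spaces *)

(* A real Hilbert space is a complete normed R-module whose norm comes from
   an inner product [ip]; no separability or dimension bound is assumed. *)
Record is_inner_product (H : CompleteNormedModule R_AbsRing)
    (ip : H -> H -> R) : Prop := {
  ip_sym : forall x y : H, ip x y = ip y x;
  ip_plus : forall x y z : H, ip (plus x y) z = ip x z + ip y z;
  ip_scal : forall (a : R) (x y : H), ip (scal a x) y = a * ip x y;
  ip_norm : forall x : H, ip x x = norm x ^ 2 }.

(* The existence of such a pair is equivalent to dim H >= 2. *)
Definition orthonormal_pair {H : CompleteNormedModule R_AbsRing}
    (ip : H -> H -> R) (e1 e2 : H) : Prop :=
  ip e1 e1 = 1 /\ ip e2 e2 = 1 /\ ip e1 e2 = 0.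

(* Surjective linear isometries.  For [V := C_R_NormedModule], the plane with
   its Euclidean norm, these are the elements of O(2). *)
Definition orthogonal {V : NormedModule R_AbsRing} (U : V -> V) : Prop :=
  is_linear U /\ (forall x : V, norm (U x) = norm x) /\
  (forall y : V, exists x : V, U x = y).

(** * Harmonic maps on the disk *)

(* Maps on the disk are represented by functions on all of [C = R * R], of
   which only the values on [disk] matter. *)
Definition disk (z : C) : Prop := Cmod z < 1.

Definition C1_on_disk {H : CompleteNormedModule R_AbsRing}
    (F Fx Fy : C -> H) : Prop :=
  forall z : C, disk z ->
    is_derive (fun x : R => F (x, snd z)) (fst z) (Fx z) /\
    is_derive (fun y : R => F (fst z, y)) (snd z) (Fy z) /\
    continuous Fx z /\ continuous Fy z.

(* C^2 with vanishing Laplacian *)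
Definition harmonic_on_disk {H : CompleteNormedModule R_AbsRing}
    (F : C -> H) : Prop :=
  exists Fx Fy Fxx Fxy Fyx Fyy : C -> H,
    C1_on_disk F Fx Fy /\ C1_on_disk Fx Fxx Fxy /\ C1_on_disk Fy Fyx Fyy /\
    forall z : C, disk z -> plus (Fxx z) (Fyy z) = zero.

Definition harmonic_disk_to_ball {H : CompleteNormedModule R_AbsRing}
    (F : C -> H) : Prop :=
  harmonic_on_disk F /\ forall z : C, disk z -> norm (F z) < 1.

(** * Stretching of the differential at the origin *)

Definition is_max_stretch0 {H : CompleteNormedModule R_AbsRing}
    (F : C -> H) (L : R) : Prop :=
  exists dF : C -> H,
    filterdiff (U := C_R_NormedModule) F (locally (RtoC 0)) dF /\
    (exists v : C, Cmod v = 1 /\ norm (dF v) = L) /\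
    (forall v : C, Cmod v = 1 -> norm (dF v) <= L).

Definition is_min_stretch0 {H : CompleteNormedModule R_AbsRing}
    (F : C -> H) (l : R) : Prop :=
  exists dF : C -> H,
    filterdiff (U := C_R_NormedModule) F (locally (RtoC 0)) dF /\
    (exists v : C, Cmod v = 1 /\ norm (dF v) = l) /\
    (forall v : C, Cmod v = 1 -> l <= norm (dF v)).

Definition quasiconformal0 {H : CompleteNormedModule R_AbsRing}
    (K : R) (F : C -> H) : Prop :=
  exists L l : R, is_max_stretch0 F L /\ is_min_stretch0 F l /\
    0 < l /\ l <= L /\ L <= K * l.

Definition admissible {H : CompleteNormedModule R_AbsRing}
    (K : R) (F : C -> H) : Prop :=
  harmonic_disk_to_ball F /\ F (RtoC 0) = zero /\ quasiconformal0 K F.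

(* M_K, as an extended real supremum *)
Definition extremal_stretch (H : CompleteNormedModule R_AbsRing)
    (K : R) : Rbar :=
  Lub_Rbar (fun L : R =>
    exists F : C -> H, admissible K F /\ is_max_stretch0 F L).

(** * Poisson integrals and the extremal family *)

(* Functions on the unit circle are given as functions of the angle [t].
   [RInt] is the Riemann integral with values in a Banach space, which agrees
   with the Bochner integral on the continuous integrands used here. *)
Definition circle_mean {V : CompleteNormedModule R_AbsRing}
    (f : R -> V) : V :=
  scal (/ (2 * PI)) (RInt f 0 (2 * PI)).

(* The kernel at z = r e^{i theta}: the usual r cos (theta - t) is
   Re z cos t + Im z sin t. *)
Definition poisson_kernel (z : C) (t : R) : R :=
  (1 - Cmod z ^ 2) /
  (1 - 2 * (fst z * cos t + snd z * sin t) + Cmod z ^ 2).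

Definition poisson {H : CompleteNormedModule R_AbsRing}
    (Phi : R -> H) (z : C) : H :=
  circle_mean (fun t : R => scal (poisson_kernel z t) (Phi t)).

Definition D_ (tau t : R) : R := sqrt (cos t ^ 2 + tau ^ 2 * sin t ^ 2).

Definition Phi {H : CompleteNormedModule R_AbsRing} (e1 e2 : H)
    (tau t : R) : H :=
  scal (/ D_ tau t) (plus (scal (cos t) e1) (scal (tau * sin t) e2)).

Definition Fext {H : CompleteNormedModule R_AbsRing} (e1 e2 : H)
    (tau : R) : C -> H :=
  poisson (Phi e1 e2 tau).

Definition alpha (tau : R) : R :=
  / PI * RInt (fun t : R => cos t ^ 2 / D_ tau t) 0 (2 * PI).

Definition beta (tau : R) : R :=
  / PI * RInt (fun t : R => tau * sin t ^ 2 / D_ tau t) 0 (2 * PI).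

Definition J (tau : R) : R := circle_mean (D_ tau).

Definition stretch_bound (K tau : R) : R := 2 * J tau / (1 + tau / K).

Definition minimizes_stretch_bound (K tau : R) : Prop :=
  0 < tau <= 1 /\
  forall s : R, 0 < s <= 1 -> stretch_bound K tau <= stretch_bound K s.

(* Main.v *)
From Stdlib Require Import Reals Lra Psatz Classical ClassicalEpsilon.
From Coquelicot Require Import Coquelicot Derive_2d.
Require Import Defs.
Open Scope R_scope.

(** Duality.  Let [F] be a competitor with singular values [L >= m >= L / K] at the
    origin, with singular vectors [u1, u2] in [H].  After a rotation of the disk, the
    first Fourier coefficients of the harmonic map [F] on the circle of radius [r] give
    [pi r (L + tau m)] as the integral of
    [<F(r exp (i t)), cos t u1 + tau sin t u2>], which is at most the integral of
    [D_tau] because [|F| < 1].  As [r -> 1] this becomes [L + tau m <= 2 J(tau)], so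
    [L <= 2 J(tau) / (1 + tau / K)] for every [tau]; this is [pairing0_le], and its
    consequence is [stretch_le].  Singular vectors exist because a unit vector [v]
    maximizing [|dF v|] has [dF v] orthogonal to the image of the direction orthogonal
    to [v] ([singular_vectors]).

    The minimization.  The derivatives of [F_tau] at the origin satisfy
    [alpha(tau) + s beta(tau) <= 2 J(s)] by Cauchy-Schwarz, with equality exactly for
    [s = tau]: the left-hand side is the tangent line at [tau] to the strictly convex
    function [2 J].  If [alpha(tau) = K beta(tau)], this tangent is [alpha(tau) (1 + s / K)],
    so [tau] is the unique minimizer of the bound and the minimum is [alpha(tau)]
    ([stretch_bound_strict], [stretch_bound_critical]).  Then [F_tau] is admissible and attains
    it.  Such a [tau] exists by the intermediate value theorem, since [alpha = beta]
    at [1] while [alpha >= 1] and [beta <= 2 sqrt tau] ([exists_critical]).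

    Rigidity.  If [F] attains the bound, then [L + tau m = 2 J(tau)], so the mean of
    [D_tau - <F, cos t u1 + tau sin t u2>] on the circle of radius [r] is
    [J(tau) (1 - r)].  Since [|F - v|^2 <= 2 (1 - <F, v>)] for a unit vector [v], the map
    [F] tends in mean square to the unit vector field along the ellipse
    ([boundary_defect]).  The Poisson integral [G] of that field satisfies the
    same equality, hence has the same limit.  For a scalar component [w] of [F - G] the
    integral of [w^2] over the circle of radius [r] increases with [r]
    ([square_mean_increasing]) and tends to [0] as [r -> 1], so [w = 0]; no boundary
    limit theorem for [F] enters.  Finally [G] is [F_tau] with the pair [(u1, u2)],
    composed with a rotation, and an orthogonal transformation takes [(e1, e2)] to
    [(u1, u2)].

    Both facts used about harmonic functions on concentric circles, the formula for
    the first Fourier coefficients and the monotonicity of the mean square, rest on the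
    polar form of Laplace's equation: the Euler field [x d/dx + y d/dy], applied twice,
    is minus the rotation field [x d/dy - y d/dx] applied twice, and the rotation
    field can be integrated by parts along circles. *)

(** * Continuity and integrals over the circle *)

Lemma continuous_Rplus {U : UniformSpace} (f g : U -> R) (x : U) :
  continuous f x -> continuous g x -> continuous (fun y => f y + g y) x.
Proof. exact (continuous_plus (V := R_NormedModule) f g x). Qed.

Lemma continuous_Rminus {U : UniformSpace} (f g : U -> R) (x : U) :
  continuous f x -> continuous g x -> continuous (fun y => f y - g y) x.
Proof. exact (continuous_minus (V := R_NormedModule) f g x). Qed.

Lemma continuous_Ropp {U : UniformSpace} (f : U -> R) (x : U) :
  continuous f x -> continuous (fun y => - f y) x.
Proof. exact (continuous_opp (V := R_NormedModule) f x). Qed.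

Lemma continuous_Rmult {U : UniformSpace} (f g : U -> R) (x : U) :
  continuous f x -> continuous g x -> continuous (fun y => f y * g y) x.
Proof. exact (continuous_mult (K := R_AbsRing) f g x). Qed.

Lemma continuous_pow {U : UniformSpace} (f : U -> R) (n : nat) (x : U) :
  continuous f x -> continuous (fun y => f y ^ n) x.
Proof.
  intros Hf; induction n as [|n IH]; simpl.
  - apply continuous_const.
  - now apply continuous_Rmult.
Qed.

Lemma continuous_inv {U : UniformSpace} (f : U -> R) (x : U) :
  f x <> 0 -> continuous f x -> continuous (fun y => / f y) x.
Proof.
  intros H0 Hf; apply (continuous_comp f Rinv); [exact Hf|].
  now apply continuous_Rinv.
Qed.

Lemma continuous_Rdiv {U : UniformSpace} (f g : U -> R) (x : U) :
  g x <> 0 -> continuous f x -> continuous g x ->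
  continuous (fun y => f y / g y) x.
Proof.
  intros; apply continuous_Rmult; [|apply continuous_inv]; assumption.
Qed.

Lemma continuous_comp_R {U : UniformSpace} (g : R -> R) (f : U -> R) (x : U) :
  (forall r, continuous g r) -> continuous f x ->
  continuous (fun y => g (f y)) x.
Proof. intros Hg Hf; now apply (continuous_comp f g). Qed.

(** [cont] follows the syntax of a real-valued function.  Denominators must be
    shown nonzero: these goals, and functions treated as atoms, go to [cont_db], and
    what it does not solve is left to the user. *)
Create HintDb cont_db.

Ltac cont :=
  intros;
  repeat (cbv beta; first
   [ assumption
   | match goal with
     | H : forall _, continuous ?f _ |- continuous ?f _ => apply H
     | |- continuous (fun y => y) _ => apply continuous_id
     | |- continuous (fun y => ?c) _ => apply continuous_const
     | |- continuous fst _ => apply continuous_fst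
     | |- continuous snd _ => apply continuous_snd
     | |- continuous cos _ => apply continuous_cos
     | |- continuous sin _ => apply continuous_sin
     | |- continuous (fun y => _ + _) _ => apply continuous_Rplus
     | |- continuous (fun y => _ - _) _ => apply continuous_Rminus
     | |- continuous (fun y => - _) _ => apply continuous_Ropp
     | |- continuous (fun y => _ * _) _ => apply continuous_Rmult
     | |- continuous (fun y => _ / _) _ => apply continuous_Rdiv
     | |- continuous (fun y => / _) _ => apply continuous_inv
     | |- continuous (fun y => _ ^ _) _ => apply continuous_pow
     | |- continuous (fun y => cos _) _ =>
         apply (continuous_comp_R cos); [exact continuous_cos|]
     | |- continuous (fun y => sin _) _ =>
         apply (continuous_comp_R sin); [exact continuous_sin|]
     | |- continuous (fun y => sqrt _) _ =>
         apply (continuous_comp_R sqrt); [exact continuous_sqrt|]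
     | |- continuous (fun y => fst y) _ => apply continuous_fst
     | |- continuous (fun y => snd y) _ => apply continuous_snd
     | |- continuous (fun y => fst _) _ =>
         apply (continuous_comp _ fst); [|apply continuous_fst]
     | |- continuous (fun y => snd _) _ =>
         apply (continuous_comp _ snd); [|apply continuous_snd]
     | H : forall _, continuous ?f _ |- continuous (fun y => ?f y) _ => apply H
     | H : forall _, continuous ?f _ |- continuous (fun y => ?f (@?g y)) _ =>
         apply (continuous_comp_R f g); [exact H|]
     end
   | solve [auto with cont_db nocore] ]).

Definition turn (f : R -> R) : R := RInt f 0 (2 * PI).

Lemma two_PI_pos : 0 < 2 * PI.
Proof. generalize PI_RGT_0; lra. Qed.

Lemma ex_RInt_cont (f : R -> R) (a b : R) :
  (forall t, continuous f t) -> ex_RInt f a b.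
Proof. intros Hf; apply (ex_RInt_continuous f); intros; apply Hf. Qed.

Lemma turn_ext (f g : R -> R) : (forall t, f t = g t) -> turn f = turn g.
Proof. intros H; apply RInt_ext; intros; apply H. Qed.

Lemma turn_plus (f g : R -> R) :
  (forall t, continuous f t) -> (forall t, continuous g t) ->
  turn (fun t => f t + g t) = turn f + turn g.
Proof.
  intros; apply (RInt_plus (V := R_CompleteNormedModule));
  now apply ex_RInt_cont.
Qed.

Lemma turn_scal (k : R) (f : R -> R) :
  (forall t, continuous f t) -> turn (fun t => k * f t) = k * turn f.
Proof.
  intros; apply (RInt_scal (V := R_CompleteNormedModule)).
  now apply ex_RInt_cont.
Qed.

Lemma turn_minus (f g : R -> R) :
  (forall t, continuous f t) -> (forall t, continuous g t) ->
  turn (fun t => f t - g t) = turn f - turn g.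
Proof.
  intros; apply (RInt_minus (V := R_CompleteNormedModule));
  now apply ex_RInt_cont.
Qed.

Lemma turn_const (c : R) : turn (fun _ => c) = 2 * PI * c.
Proof.
  unfold turn; rewrite RInt_const; change (scal (2 * PI - 0) c) with
    ((2 * PI - 0) * c); ring.
Qed.

Lemma turn_le (f g : R -> R) :
  (forall t, continuous f t) -> (forall t, continuous g t) ->
  (forall t, f t <= g t) -> turn f <= turn g.
Proof.
  intros; apply RInt_le; try (now apply ex_RInt_cont).
  - apply Rlt_le, two_PI_pos.
  - auto.
Qed.

Lemma turn_ge_0 (f : R -> R) :
  (forall t, continuous f t) -> (forall t, 0 <= f t) -> 0 <= turn f.
Proof.
  intros; apply RInt_ge_0; try (now apply ex_RInt_cont).
  - apply Rlt_le, two_PI_pos.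
  - auto.
Qed.

Lemma turn_derive (f f' : R -> R) :
  (forall t, is_derive f t (f' t)) -> (forall t, continuous f' t) ->
  turn f' = f (2 * PI) - f 0.
Proof.
  intros Hd Hc; apply is_RInt_unique.
  apply (is_RInt_derive (V := R_CompleteNormedModule) f f'); intros; auto.
Qed.

Lemma turn_shift (f : R -> R) (a : R) :
  (forall t, continuous f t) -> (forall t, f (t + 2 * PI) = f t) ->
  turn (fun t => f (t + a)) = turn f.
Proof.
  intros Hc Hp.
  assert (E : forall p q, ex_RInt f p q) by (intros; now apply ex_RInt_cont).
  assert (S : forall b p q, RInt (fun t => f (t + b)) p q = RInt f (p + b) (q + b)).
  { intros b p q.
    generalize (RInt_comp_lin (V := R_CompleteNormedModule) f 1 b p q (E _ _)).
    replace (1 * p + b) with (p + b) by ring.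
    replace (1 * q + b) with (q + b) by ring.
    intros <-; apply RInt_ext; intros x _.
    change (scal 1 (f (1 * x + b))) with (1 * f (1 * x + b)).
    rewrite !Rmult_1_l; reflexivity. }
  unfold turn; rewrite S.
  assert (Ha : RInt f 0 a = RInt f (2 * PI) (2 * PI + a)).
  { rewrite <- (RInt_ext (fun t => f (t + 2 * PI)) f 0 a) by (intros; apply Hp).
    rewrite S; f_equal; ring. }
  generalize (RInt_Chasles (V := R_CompleteNormedModule) f 0 a (2 * PI + a)
    (E _ _) (E _ _)).
  generalize (RInt_Chasles (V := R_CompleteNormedModule) f 0 (2 * PI) (2 * PI + a)
    (E _ _) (E _ _)).
  change (plus ?x ?y) with (x + y).
  replace (0 + a) with a by ring. lra.
Qed.

Lemma turn_refl (f : R -> R) :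
  (forall t, continuous f t) -> turn (fun t => f (2 * PI - t)) = turn f.
Proof.
  intros Hc.
  assert (E : forall p q, ex_RInt f p q) by (intros; now apply ex_RInt_cont).
  generalize (RInt_comp_lin (V := R_CompleteNormedModule) f (-1) (2 * PI) 0 (2 * PI)
    (E _ _)).
  replace (-1 * 0 + 2 * PI) with (2 * PI) by ring.
  replace (-1 * (2 * PI) + 2 * PI) with 0 by ring.
  rewrite <- (opp_RInt_swap f 0 (2 * PI)) by apply E.
  rewrite (RInt_ext _ (fun y => -1 * f (2 * PI - y))).
  2: { intros x _; change (scal (-1) (f (-1 * x + 2 * PI))) with
         (-1 * f (-1 * x + 2 * PI)); do 2 f_equal; ring. }
  change (RInt (fun y => -1 * f (2 * PI - y)) 0 (2 * PI)) with
    (turn (fun y => -1 * f (2 * PI - y))).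
  rewrite turn_scal.
  2: { intros t; apply (continuous_comp (fun t => 2 * PI - t) f); [cont|apply Hc]. }
  change (opp ?x) with (- x); fold (turn f); lra.
Qed.

(** The integral is invariant under the half-turn, which reverses the sign of [f]. *)
Lemma turn_antiperiodic (f : R -> R) : (forall t, continuous f t) ->
  (forall t, f (t + PI) = - f t) -> turn f = 0.
Proof.
  intros K Hf.
  assert (Hp : forall t, f (t + 2 * PI) = f t).
  { intros t; replace (t + 2 * PI) with (t + PI + PI) by ring; rewrite !Hf; ring. }
  pose proof (turn_shift f PI K Hp) as E.
  rewrite (turn_ext _ (fun t => -1 * f t)) in E by (intros; rewrite Hf; ring).
  rewrite turn_scal in E by auto. lra.
Qed.

Lemma turn_eq_0 (f : R -> R) :
  (forall t, continuous f t) -> (forall t, 0 <= f t) -> turn f = 0 ->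
  forall t, 0 <= t <= 2 * PI -> f t = 0.
Proof.
  intros Hc Hp H0 t Ht.
  destruct (Rle_lt_or_eq_dec 0 (f t) (Hp t)) as [Hl|]; [exfalso|auto].
  assert (E : forall p q, ex_RInt f p q) by (intros; now apply ex_RInt_cont).
  assert (h : 0 < f t / 2) by lra.
  destruct (proj1 (filterlim_locally f (f t)) (Hc t) (mkposreal _ h)) as [d Hd].
  pose proof (cond_pos d) as d0.
  set (a := Rmax 0 (t - d / 2)); set (b := Rmin (2 * PI) (t + d / 2)).
  assert (Hab : a < b /\ 0 <= a /\ b <= 2 * PI /\ t - d / 2 <= a /\ b <= t + d / 2).
  { generalize two_PI_pos; unfold a, b, Rmax, Rmin.
    destruct (Rle_dec 0 (t - d / 2)), (Rle_dec (2 * PI) (t + d / 2)); lra. }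
  assert (H1 : (b - a) * (f t / 2) <= RInt f a b).
  { replace ((b - a) * (f t / 2)) with (RInt (fun _ => f t / 2) a b).
    2: { rewrite RInt_const; reflexivity. }
    apply RInt_le; [lra|apply ex_RInt_const|apply E|].
    intros x Hx.
    assert (Hb : ball t d x).
    { apply Rabs_lt_between'; simpl; lra. }
    specialize (Hd x Hb); apply Rabs_lt_between' in Hd; simpl in Hd; lra. }
  assert (H2 : 0 <= RInt f 0 a) by (apply RInt_ge_0; [lra|apply E|intros; apply Hp]).
  assert (H3 : 0 <= RInt f b (2 * PI)) by (apply RInt_ge_0; [lra|apply E|intros; apply Hp]).
  generalize (RInt_Chasles (V := R_CompleteNormedModule) f 0 a b (E _ _) (E _ _)).
  generalize (RInt_Chasles (V := R_CompleteNormedModule) f 0 b (2 * PI) (E _ _) (E _ _)).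
  change (plus ?x ?y) with (x + y); unfold turn in H0.
  assert (0 < (b - a) * (f t / 2)) by (apply Rmult_lt_0_compat; lra).
  lra.
Qed.

Lemma cos_plus_2PI (t : R) : cos (t + 2 * PI) = cos t.
Proof. rewrite cos_plus, cos_2PI, sin_2PI; ring. Qed.
Lemma sin_plus_2PI (t : R) : sin (t + 2 * PI) = sin t.
Proof. rewrite sin_plus, cos_2PI, sin_2PI; ring. Qed.

Lemma cos2_sin2 (t : R) : cos t ^ 2 + sin t ^ 2 = 1.
Proof. generalize (sin2_cos2 t); unfold Rsqr; intros; nra. Qed.

Lemma turn_cos2 : turn (fun t => cos t ^ 2) = PI.
Proof.
  rewrite (turn_derive (fun t => t / 2 + sin t * cos t / 2) (fun t => cos t ^ 2)).
  - rewrite sin_2PI, sin_0; field.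
  - intros t; auto_derive; auto; generalize (cos2_sin2 t); nra.
  - cont.
Qed.

Lemma turn_sin2 : turn (fun t => sin t ^ 2) = PI.
Proof.
  rewrite (turn_ext _ (fun t => 1 - cos t ^ 2)) by (intros t; generalize (cos2_sin2 t); lra).
  rewrite turn_minus by cont. rewrite turn_const, turn_cos2; ring.
Qed.

Lemma turn_cos_sin : turn (fun t => cos t * sin t) = 0.
Proof.
  rewrite (turn_derive (fun t => sin t ^ 2 / 2) (fun t => cos t * sin t)).
  - rewrite sin_2PI, sin_0; field.
  - intros t; auto_derive; auto; field.
  - cont.
Qed.

(** * Integrals depending on a parameter *)

(** Joint continuity along the compact set [{z} x [0, 2 pi]] is uniform, by a
    Lebesgue-number argument. *)
Lemma continuous_turn {U : UniformSpace} (k : U -> R -> R) (z : U) :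
  (forall t, continuous (fun p : U * R => k (fst p) (snd p)) (z, t)) ->
  locally z (fun y => forall t, continuous (k y) t) ->
  continuous (fun y => turn (k y)) z.
Proof.
  intros Hj Hl; apply filterlim_locally; intros eps.
  pose proof two_PI_pos as P0.
  assert (e0 : 0 < eps / (2 * PI) / 4).
  { repeat apply Rdiv_lt_0_compat; try lra; apply eps. }
  set (e := mkposreal _ e0).
  assert (Hd : forall t, exists d : posreal, forall y s,
    ball z d y -> ball t d s -> Rabs (k y s - k z t) < e).
  { intros t; destruct (proj1 (filterlim_locally _ _) (Hj t) e) as [d Hd].
    exists d; intros y s Hy Hs; apply (Hd (y, s)); split; assumption. }
  set (delta := fun t => proj1_sig (constructive_indefinite_description _ (Hd t))).
  assert (Hdelta : forall t y s,
    ball z (delta t) y -> ball t (delta t) s -> Rabs (k y s - k z t) < e).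
  { intros t; unfold delta.
    destruct (constructive_indefinite_description _ (Hd t)) as [d Hdd]; exact Hdd. }
  destruct (Compactness.compactness_value_1d 0 (2 * PI) delta) as [d Hc].
  destruct Hl as [d' Hl].
  assert (Hz : forall t, continuous (k z) t) by (apply Hl, ball_center).
  exists (mkposreal _ (Rmin_stable_in_posreal d d')); intros y Hy; simpl in Hy.
  assert (Hy1 : ball z d y) by (eapply ball_le; [apply Rmin_l|exact Hy]).
  assert (Hy2 : forall t, continuous (k y) t)
    by (apply Hl; eapply ball_le; [apply Rmin_r|exact Hy]).
  change (Rabs (turn (k y) - turn (k z)) < eps).
  rewrite <- turn_minus by auto.
  apply Rle_lt_trans with ((2 * PI - 0) * (eps / (2 * PI) / 2)).
  - apply (abs_RInt_le_const (fun t => k y t - k z t)); [lra|apply ex_RInt_cont; cont|].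
    intros t Ht; apply NNPP; intros N; apply (Hc t Ht); intros [i [Hi [Hti Hdi]]].
    apply N.
    assert (A1 : Rabs (k y t - k z i) < e).
    { apply Hdelta; [eapply ball_le; eauto|exact Hti]. }
    assert (A2 : Rabs (k z t - k z i) < e).
    { apply Hdelta; [apply ball_center|exact Hti]. }
    apply Rabs_lt_between in A1; apply Rabs_lt_between in A2; simpl in A1, A2.
    apply Rabs_le_between; lra.
  - pose proof (cond_pos eps).
    replace ((2 * PI - 0) * (eps / (2 * PI) / 2)) with (eps / 2) by (field; apply PI_neq0).
    lra.
Qed.

(** Differentiation under the integral sign, the derivative of the
    integrand being an explicit function [k'] rather than a term in [Derive]. *)
Lemma is_derive_turn (k k' : R -> R -> R) (x : R) :
  locally x (fun y => forall t, is_derive (fun u => k u t) y (k' y t)) ->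
  (forall t, continuous (fun p : R * R => k' (fst p) (snd p)) (x, t)) ->
  locally x (fun y => forall t, continuous (k y) t) ->
  is_derive (fun u => turn (k u)) x (turn (k' x)).
Proof.
  intros Hd Hk' Hk.
  assert (E : turn (k' x) = RInt (fun t => Derive (fun u => k u t) x) 0 (2 * PI)).
  { apply RInt_ext; intros t _; symmetry; apply is_derive_unique.
    apply (locally_singleton _ _ Hd). }
  rewrite E; apply is_derive_RInt_param.
  - eapply filter_imp; [|exact Hd]; intros y Hy t _; eexists; apply Hy.
  - intros t _.
    apply continuity_2d_pt_ext_loc with k'.
    + destruct Hd as [d Hd]; exists d; intros u v Hu Hv.
      symmetry; apply is_derive_unique, Hd; exact Hu.
    + apply continuity_2d_pt_filterlim; exact (Hk' t).
  - eapply filter_imp; [|exact Hk]; intros y Hy; now apply ex_RInt_cont.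
Qed.

(** * The numbers alpha, beta and J *)

Lemma le_of_sq_le (x y : R) : 0 <= y -> x ^ 2 <= y ^ 2 -> x <= y.
Proof. intros; nra. Qed.

Lemma D_sq (tau t : R) : D_ tau t ^ 2 = cos t ^ 2 + tau ^ 2 * sin t ^ 2.
Proof. 
  unfold D_; rewrite pow2_sqrt; [reflexivity|].
  generalize (pow2_ge_0 (cos t)) (pow2_ge_0 (tau * sin t)).
  rewrite Rpow_mult_distr; lra.
Qed.

Lemma D_nonneg (tau t : R) : 0 <= D_ tau t.
Proof. apply sqrt_pos. Qed.

Lemma D_pos (tau t : R) : 0 < tau -> 0 < D_ tau t.
Proof.
  intros Ht; apply sqrt_lt_R0; generalize (cos2_sin2 t); intros.
  destruct (Req_dec (sin t) 0) as [E|E].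
  - rewrite E in *; nra.
  - assert (0 < sin t ^ 2) by (apply pow2_gt_0; auto).
    assert (0 < tau ^ 2) by nra. nra.
Qed.

Lemma D_le_1 (tau t : R) : 0 < tau <= 1 -> D_ tau t <= 1.
Proof.
  intros Ht; apply le_of_sq_le; [lra|]; rewrite D_sq.
  assert (H2 : tau ^ 2 <= 1) by (simpl; nra).
  pose proof (Rmult_le_compat_r _ _ _ (pow2_ge_0 (sin t)) H2).
  generalize (cos2_sin2 t); lra.
Qed.

Lemma D_ge (tau t : R) : 0 < tau <= 1 -> tau <= D_ tau t.
Proof.
  intros Ht; apply le_of_sq_le; [apply D_nonneg|]; rewrite D_sq.
  assert (H2 : tau ^ 2 <= 1) by (simpl; nra).
  pose proof (Rmult_le_compat_r _ _ _ (pow2_ge_0 (cos t)) H2).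
  replace (sin t ^ 2) with (1 - cos t ^ 2) by (generalize (cos2_sin2 t); lra). lra.
Qed.

Lemma D_1 (t : R) : D_ 1 t = 1.
Proof.
  unfold D_; replace (cos t ^ 2 + 1 ^ 2 * sin t ^ 2) with 1; [apply sqrt_1|].
  generalize (cos2_sin2 t); lra.
Qed.

Lemma continuous_D (tau t : R) : continuous (D_ tau) t.
Proof.
  apply (continuous_comp_R sqrt); [exact continuous_sqrt|cont].
Qed.

#[local] Hint Extern 1 (continuous (D_ _) _) => apply continuous_D : cont_db.
#[local] Hint Extern 1 (continuous (fun _ => D_ _ _) _) => apply continuous_D : cont_db.
#[local] Hint Extern 1 (D_ _ _ <> 0) =>
  apply Rgt_not_eq, D_pos; lra : cont_db.
#[local] Hint Extern 1 (D_ _ _ ^ _ <> 0) =>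
  apply pow_nonzero, Rgt_not_eq, D_pos; lra : cont_db.

Lemma D_PI (tau t : R) : D_ tau (t + PI) = D_ tau t.
Proof.
  unfold D_; rewrite neg_cos, neg_sin; f_equal; ring.
Qed.

Lemma J_turn (tau : R) : 2 * J tau = / PI * turn (D_ tau).
Proof.
  unfold J, circle_mean; fold (turn (D_ tau)).
  change (scal ?x ?y) with (x * y); field; apply PI_neq0.
Qed.

Lemma D_periodic (tau t : R) : D_ tau (t + 2 * PI) = D_ tau t.
Proof. unfold D_; now rewrite cos_plus_2PI, sin_plus_2PI. Qed.

(** Cauchy-Schwarz: the left-hand side is [<v_tau / |v_tau|, v_s>], where
    [v_s = (cos t, s sin t)] has norm [D_s]. *)
Lemma CS_pointwise (tau s t : R) : 0 < tau ->
  (cos t ^ 2 + s * tau * sin t ^ 2) / D_ tau t <= D_ s t.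
Proof.
  intros Ht; pose proof (D_pos tau t Ht) as HD.
  apply Rle_div_l; [exact HD|].
  apply le_of_sq_le.
  - apply Rmult_le_pos; [apply D_nonneg|lra].
  - rewrite Rpow_mult_distr, !D_sq.
    assert (0 <= (cos t * sin t * (s - tau)) ^ 2) by apply pow2_ge_0. nra.
Qed.

Lemma alpha_beta_turn (tau s : R) : 0 < tau ->
  alpha tau + s * beta tau =
  / PI * turn (fun t => (cos t ^ 2 + s * tau * sin t ^ 2) / D_ tau t).
Proof.
  intros Ht; unfold alpha, beta.
  fold (turn (fun t => cos t ^ 2 / D_ tau t)).
  fold (turn (fun t => tau * sin t ^ 2 / D_ tau t)).
  rewrite (turn_ext (fun t => (cos t ^ 2 + s * tau * sin t ^ 2) / D_ tau t)
    (fun t => cos t ^ 2 / D_ tau t + s * (tau * sin t ^ 2 / D_ tau t))).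
  - rewrite turn_plus, turn_scal by cont; ring.
  - intros t; field; apply Rgt_not_eq, D_pos; lra.
Qed.

Lemma PI_inv_pos : 0 < / PI.
Proof. apply Rinv_0_lt_compat, PI_RGT_0. Qed.

(** [2 J] is convex in its parameter, and the left-hand side is its tangent at
    [tau]. *)
Lemma tangent_bound (tau s : R) : 0 < tau ->
  alpha tau + s * beta tau <= 2 * J s.
Proof.
  intros Ht; rewrite alpha_beta_turn, J_turn by auto.
  apply Rmult_le_compat_l; [apply Rlt_le, PI_inv_pos|].
  apply turn_le; [cont|cont|]. intros t; now apply CS_pointwise.
Qed.

(** The integrands of the two sides differ at [t = PI / 4]. *)
Lemma tangent_bound_strict (tau s : R) : 0 < tau -> 0 < s -> s <> tau ->
  alpha tau + s * beta tau < 2 * J s.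
Proof.
  intros Ht Hs Hst.
  destruct (Rle_lt_or_eq_dec _ _ (tangent_bound tau s Ht)) as [|E]; [auto|exfalso].
  rewrite alpha_beta_turn, J_turn in E by auto.
  apply Rmult_eq_reg_l in E; [|apply Rgt_not_eq, PI_inv_pos].
  set (f := fun t => D_ s t - (cos t ^ 2 + s * tau * sin t ^ 2) / D_ tau t).
  assert (F0 : f (PI / 4) = 0).
  { apply turn_eq_0.
    - unfold f; cont.
    - intros t; unfold f; generalize (CS_pointwise tau s t Ht); lra.
    - unfold f; rewrite turn_minus by cont; lra.
    - generalize PI_RGT_0; lra. }
  unfold f in F0.
  pose proof (D_pos tau (PI / 4) Ht) as HD.
  assert (F1 : D_ s (PI / 4) * D_ tau (PI / 4) =
               cos (PI / 4) ^ 2 + s * tau * sin (PI / 4) ^ 2).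
  { replace (D_ s (PI / 4)) with
      ((cos (PI / 4) ^ 2 + s * tau * sin (PI / 4) ^ 2) / D_ tau (PI / 4)) by lra.
    field; lra. }
  apply (f_equal (fun x => x ^ 2)) in F1.
  rewrite Rpow_mult_distr, !D_sq in F1.
  rewrite <- sin_cos_PI4 in F1.
  assert (Hc : sin (PI / 4) ^ 2 = 1 / 2).
  { generalize (cos2_sin2 (PI / 4)); rewrite <- sin_cos_PI4; lra. }
  rewrite Hc in F1.
  apply Hst; assert (Z : (s - tau) ^ 2 = 0) by nra.
  apply Rminus_diag_uniq; destruct (Req_dec (s - tau) 0) as [|N]; auto.
  exfalso; apply (pow_nonzero _ 2 N Z).
Qed.

Lemma alpha_tau_beta (tau : R) : 0 < tau -> alpha tau + tau * beta tau = 2 * J tau.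
Proof.
  intros Ht; rewrite alpha_beta_turn, J_turn by auto; f_equal.
  apply turn_ext; intros t.
  replace (cos t ^ 2 + tau * tau * sin t ^ 2) with (D_ tau t ^ 2)
    by (rewrite D_sq; ring).
  field; apply Rgt_not_eq, D_pos; lra.
Qed.

Lemma alpha_ge_1 (tau : R) : 0 < tau <= 1 -> 1 <= alpha tau.
Proof.
  intros Ht; unfold alpha; fold (turn (fun t => cos t ^ 2 / D_ tau t)).
  replace 1 with (/ PI * PI) by (field; apply PI_neq0).
  apply Rmult_le_compat_l; [apply Rlt_le, PI_inv_pos|].
  rewrite <- turn_cos2 at 1; apply turn_le; [cont|cont|].
  intros t; pose proof (D_pos tau t (proj1 Ht)).
  apply (Rle_div_r _ _ (D_ tau t)); [assumption|].
  rewrite <- (Rmult_1_r (cos t ^ 2)) at 2.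
  apply Rmult_le_compat_l; [apply pow2_ge_0|now apply D_le_1].
Qed.

Lemma beta_ge (tau : R) : 0 < tau <= 1 -> tau <= beta tau.
Proof.
  intros Ht; unfold beta; fold (turn (fun t => tau * sin t ^ 2 / D_ tau t)).
  replace tau with (/ PI * (tau * PI)) at 1 by (field; apply PI_neq0).
  apply Rmult_le_compat_l; [apply Rlt_le, PI_inv_pos|].
  rewrite <- turn_sin2, <- turn_scal at 1 by cont.
  apply turn_le; [cont|cont|].
  intros t; pose proof (D_pos tau t (proj1 Ht)).
  apply (Rle_div_r _ _ (D_ tau t)); [assumption|].
  rewrite <- (Rmult_1_r (tau * sin t ^ 2)) at 2.
  apply Rmult_le_compat_l; [|now apply D_le_1].
  apply Rmult_le_pos; [lra|apply pow2_ge_0].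
Qed.

Lemma alpha_1_eq_beta_1 : alpha 1 = beta 1.
Proof.
  assert (E : alpha 1 + -1 * beta 1 = 0); [|lra].
  rewrite alpha_beta_turn by lra.
  rewrite (turn_ext _ (fun t => cos t ^ 2 - sin t ^ 2)).
  - rewrite turn_minus, turn_cos2, turn_sin2 by cont; ring.
  - intros t; rewrite D_1; field.
Qed.

(** Rotating by a quarter turn exchanges the axes of the ellipse
    [(cos t, tau sin t)], so Cauchy-Schwarz against the rotated ellipse gives
    [tau alpha + beta <= alpha + tau beta]. *)
Lemma beta_le_alpha (tau : R) : 0 < tau <= 1 -> beta tau <= alpha tau.
Proof.
  intros Ht.
  destruct (Req_dec tau 1) as [->|H1].
  - rewrite alpha_1_eq_beta_1; lra.
  - assert (E : tau * (alpha tau + / tau * beta tau) <= 2 * J tau).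
    { rewrite alpha_beta_turn, J_turn by lra.
      replace (tau * (/ PI * turn (fun t => (cos t ^ 2 + / tau * tau * sin t ^ 2) / D_ tau t)))
        with (/ PI * (tau * turn (fun t => (cos t ^ 2 + / tau * tau * sin t ^ 2) / D_ tau t)))
        by ring.
      apply Rmult_le_compat_l; [apply Rlt_le, PI_inv_pos|].
      rewrite <- turn_scal by cont.
      rewrite <- (turn_shift (D_ tau) (PI / 2)) by (apply continuous_D || apply D_periodic).
      apply turn_le.
      - cont.
      - intros t; apply (continuous_comp (fun t => t + PI / 2) (D_ tau));
          [cont|apply continuous_D].
      - intros t; pose proof (D_pos tau t (proj1 Ht)) as HD.
        replace (tau * ((cos t ^ 2 + / tau * tau * sin t ^ 2) / D_ tau t))
          with (tau * (cos t ^ 2 + sin t ^ 2) / D_ tau t) by (field; lra).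
        apply Rle_div_l; [exact HD|]. 
        apply le_of_sq_le.
        + apply Rmult_le_pos; [apply D_nonneg|lra].
        + rewrite (Rpow_mult_distr (D_ _ _)), !D_sq.
          replace (cos (t + PI / 2)) with (- sin t)
            by (rewrite cos_plus, cos_PI2, sin_PI2; ring).
          replace (sin (t + PI / 2)) with (cos t)
            by (rewrite sin_plus, cos_PI2, sin_PI2; ring).
          assert (0 <= (cos t * sin t * (1 - tau ^ 2)) ^ 2) by apply pow2_ge_0. nra. }
    rewrite <- alpha_tau_beta in E by lra.
    replace (tau * (alpha tau + / tau * beta tau)) with (tau * alpha tau + beta tau) in E
      by (field; lra).
    assert (0 <= (1 - tau) * (alpha tau - beta tau)) by lra. nra.
Qed.

(** [tau / D_tau^2] is a Poisson kernel in the angle [2 t], whence the closed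
    form of its primitive, a continuous branch of [atan (tau tan t)]. *)
Lemma turn_tau_D2 (tau : R) : 0 < tau ->
  turn (fun t => tau / D_ tau t ^ 2) = 2 * PI.
Proof.
  intros Ht.
  assert (P : forall t, 0 < cos t ^ 2 + tau * sin t ^ 2).
  { intros t; generalize (cos2_sin2 t) (pow2_ge_0 (sin t)) (pow2_ge_0 (cos t)); intros.
    destruct (Req_dec (sin t ^ 2) 0) as [E|E]; [rewrite E in *; lra|].
    assert (0 < sin t ^ 2) by lra. nra. }
  rewrite (turn_derive
    (fun t => t - atan ((1 - tau) * (sin t * cos t) / (cos t ^ 2 + tau * sin t ^ 2)))).
  - rewrite sin_2PI, cos_2PI, sin_0, cos_0.
    replace ((1 - tau) * (0 * 1) / (1 ^ 2 + tau * 0 ^ 2)) with 0 by field.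
    rewrite atan_0; ring.
  - intros t; pose proof (P t) as Pt.
    pose proof (D_sq tau t) as E; pose proof (D_pos tau t Ht) as HD.
    auto_derive; [simpl in Pt; lra|].
    rewrite E.
    assert (Q : 0 < cos t ^ 2 + tau ^ 2 * sin t ^ 2) by (rewrite <- E; nra).
    pose proof (cos2_sin2 t) as CS.
    set (c := cos t) in *; set (s := sin t) in *.
    assert (Q' : 0 < (c ^ 2 + tau * s ^ 2) ^ 2 + ((1 - tau) * (s * c)) ^ 2).
    { assert (0 <= ((1 - tau) * (s * c)) ^ 2) by apply pow2_ge_0. nra. }
    assert (G : (c ^ 2 + tau * s ^ 2) ^ 2 + ((1 - tau) * (s * c)) ^ 2 =
                c ^ 2 + tau ^ 2 * s ^ 2).
    { replace (c ^ 2) with (1 - s ^ 2) by lra.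
      replace (((1 - tau) * (s * c)) ^ 2) with ((1 - tau) ^ 2 * s ^ 2 * c ^ 2) by ring.
      replace (c ^ 2) with (1 - s ^ 2) by lra. ring. }
    transitivity (1 - (1 - tau) * ((c ^ 2 + s ^ 2) * (c ^ 2 - tau * s ^ 2))
        / ((c ^ 2 + tau * s ^ 2) ^ 2 + ((1 - tau) * (s * c)) ^ 2)).
    + field; split; simpl in *; lra.
    + rewrite G, CS. replace (c ^ 2) with (1 - s ^ 2) by lra. field.
      replace (1 - s ^ 2) with (c ^ 2) by lra. lra.
  - cont.
Qed.

(** The ratio [alpha / beta] is therefore unbounded near [0].  The proof is AM-GM
    against the integral of [tau / D_tau^2], with the weight [sqrt tau] that balances
    the two terms. *)
Lemma beta_le_sqrt (tau : R) : 0 < tau <= 1 -> beta tau <= 2 * sqrt tau.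
Proof.
  intros Ht; unfold beta; fold (turn (fun t => tau * sin t ^ 2 / D_ tau t)).
  assert (Hs : 0 < sqrt tau) by (apply sqrt_lt_R0; lra).
  assert (Hss : sqrt tau * sqrt tau = tau) by (apply sqrt_sqrt; lra).
  set (l := sqrt tau) in *.
  replace (2 * l) with (/ PI * (2 * PI * (l / 2) + l / 2 * (2 * PI)))
    by (field; apply PI_neq0).
  apply Rmult_le_compat_l; [apply Rlt_le, PI_inv_pos|].
  rewrite <- (turn_tau_D2 tau) at 2 by lra.
  rewrite <- turn_const, <- turn_scal, <- turn_plus by cont.
  apply turn_le; [cont|cont|]. intros t.
  pose proof (D_pos tau t (proj1 Ht)) as HD.
  apply Rle_trans with (tau / D_ tau t).
  - apply Rmult_le_compat_r; [apply Rlt_le, Rinv_0_lt_compat, HD|].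
    generalize (cos2_sin2 t) (pow2_ge_0 (cos t)); intros; nra.
  - set (d := D_ tau t) in *. replace (tau / d) with (l * (l / d)) by (rewrite <- Hss; field; lra).
    replace (l / 2 + l / 2 * (tau / d ^ 2)) with
      (l * ((1 + (l / d) ^ 2) / 2)) by (rewrite <- Hss; field; lra).
    apply Rmult_le_compat_l; [lra|].
    generalize (pow2_ge_0 (1 - l / d)); lra.
Qed.

Lemma continuous_alpha_beta (tau : R) : 0 < tau ->
  continuous alpha tau /\ continuous beta tau.
Proof.
  intros Ht.
  assert (L : locally tau (fun s => 0 < s)) by (apply (open_gt 0 tau Ht)).
  assert (N : forall t, sqrt (cos t ^ 2 + tau ^ 2 * sin t ^ 2) <> 0).
  { intros t; apply Rgt_not_eq, (D_pos tau t Ht). }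
  split; apply continuous_Rmult; try apply continuous_const.
  - apply (continuous_turn (fun s t => cos t ^ 2 / D_ s t)).
    + intros t; unfold D_; cont; apply N.
    + eapply filter_imp; [|exact L]; cont.
  - apply (continuous_turn (fun s t => s * sin t ^ 2 / D_ s t)).
    + intros t; unfold D_; cont; apply N.
    + eapply filter_imp; [|exact L]; cont.
Qed.

Lemma exists_critical (K : R) : 1 <= K ->
  exists tau, 0 < tau <= 1 /\ alpha tau = K * beta tau.
Proof.
  intros HK.
  pose proof alpha_1_eq_beta_1 as E1.
  destruct (Req_dec K 1) as [->|HK1]; [exists 1; lra|].
  (* at this point beta <= 2 sqrt a = 1 / (2 K), while alpha >= 1 *)
  set (a := (/ (4 * K)) ^ 2).
  assert (Ha0 : 0 < / (4 * K)) by (apply Rinv_0_lt_compat; lra).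
  assert (Ha2 : / (4 * K) * (4 * K) = 1) by (field; lra).
  assert (Ha : 0 < a < 1) by (unfold a; split; [now apply pow_lt|simpl; nra]).
  assert (Hs : sqrt a = / (4 * K)) by (unfold a; apply sqrt_pow2; lra).
  destruct (Ranalysis5.IVT_interv (fun t => K * beta t - alpha t) a 1) as [z [Hz Ez]].
  - intros x Hx; apply continuity_pt_filterlim.
    destruct (continuous_alpha_beta x) as [Ca Cb]; [lra|].
    apply (continuous_Rminus (fun t => K * beta t) alpha); [|exact Ca].
    apply continuous_Rmult; [apply continuous_const|exact Cb].
  - lra.
  - assert (Ha1 : 0 < a <= 1) by lra.
    pose proof (beta_le_sqrt a Ha1) as Hb; rewrite Hs in Hb.
    pose proof (alpha_ge_1 a Ha1).
    assert (K * beta a <= K * (2 * / (4 * K))) by (apply Rmult_le_compat_l; lra).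
    replace (K * (2 * / (4 * K))) with (1 / 2) in * by (field; lra). lra.
  - pose proof (beta_ge 1 ltac:(lra)). rewrite E1. nra.
  - exists z; lra.
Qed.

Lemma stretch_bound_critical (K tau : R) : 1 <= K -> 0 < tau <= 1 ->
  alpha tau = K * beta tau -> stretch_bound K tau = alpha tau.
Proof.
  intros HK Ht E; unfold stretch_bound; rewrite <- alpha_tau_beta by lra.
  assert (0 < tau / K) by (apply Rdiv_lt_0_compat; lra).
  apply Rmult_eq_reg_r with (1 + tau / K); [|lra].
  rewrite E; field; split; [lra|]. nra.
Qed.

(** The tangent line of [2 J] at a point with [alpha = K beta] is proportional
    to [1 + s / K]: this makes the critical point a strict minimum. *)
Lemma stretch_bound_strict (K tau s : R) : 1 <= K -> 0 < tau <= 1 ->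
  alpha tau = K * beta tau -> 0 < s -> s <> tau -> alpha tau < stretch_bound K s.
Proof.
  intros HK Ht E Hs Hst; unfold stretch_bound.
  assert (0 < s / K) by (apply Rdiv_lt_0_compat; lra).
  apply (Rlt_div_r _ _ (1 + s / K)); [lra|].
  pose proof (tangent_bound_strict tau s (proj1 Ht) Hs Hst) as T.
  replace (beta tau) with (alpha tau / K) in T by (rewrite E; field; lra).
  replace (alpha tau * (1 + s / K)) with (alpha tau + s * (alpha tau / K))
    by (field; lra). exact T.
Qed.

(** * Functions of class C1 on the disk *)

Notation C1 := (C1_on_disk (H := R_CompleteNormedModule)).

Lemma Cmod_sq (z : C) : Cmod z ^ 2 = fst z ^ 2 + snd z ^ 2.
Proof.
  unfold Cmod; rewrite pow2_sqrt; [reflexivity|].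
  generalize (pow2_ge_0 (fst z)) (pow2_ge_0 (snd z)); lra.
Qed.

Lemma disk_iff (z : C) : disk z <-> fst z ^ 2 + snd z ^ 2 < 1.
Proof.
  unfold disk; rewrite <- Cmod_sq; pose proof (Cmod_ge_0 z).
  split; intros; [nra|]. destruct (Rlt_dec (Cmod z) 1); [auto|nra].
Qed.

Lemma locally_disk (z : C) : disk z -> locally z disk.
Proof.
  intros Hz; rewrite disk_iff in Hz.
  assert (Hc : continuous (fun z : R * R => fst z ^ 2 + snd z ^ 2) z) by cont.
  generalize (Hc _ (open_lt 1 _ Hz)); unfold filtermap.
  apply filter_imp; intros; now apply disk_iff.
Qed.

Lemma locally_disk_x (z : C) : disk z -> locally (fst z) (fun x => disk (x, snd z)).
Proof.
  intros Hz; rewrite disk_iff in Hz.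
  assert (Hc : continuous (fun x : R => x ^ 2 + snd z ^ 2) (fst z)) by cont.
  generalize (Hc _ (open_lt 1 _ Hz)); unfold filtermap.
  apply filter_imp; intros; now apply disk_iff.
Qed.

Lemma locally_disk_y (z : C) : disk z -> locally (snd z) (fun y => disk (fst z, y)).
Proof.
  intros Hz; rewrite disk_iff in Hz.
  assert (Hc : continuous (fun y : R => fst z ^ 2 + y ^ 2) (snd z)) by cont.
  generalize (Hc _ (open_lt 1 _ Hz)); unfold filtermap.
  apply filter_imp; intros; now apply disk_iff.
Qed.

Lemma is_derive_eq (f : R -> R) (x l l' : R) :
  is_derive f x l -> l = l' -> is_derive f x l'.
Proof. now intros ? <-. Qed.

Lemma C1_on_disk_ext {H : CompleteNormedModule R_AbsRing} (F G Fx Fy Gx Gy : C -> H) :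
  (forall z, disk z -> F z = G z) -> (forall z, disk z -> Fx z = Gx z) ->
  (forall z, disk z -> Fy z = Gy z) ->
  C1_on_disk F Fx Fy -> C1_on_disk G Gx Gy.
Proof.
  intros E Ex Ey HF z Hz; destruct (HF z Hz) as (D1 & D2 & K1 & K2).
  rewrite <- Ex, <- Ey by auto.
  pose proof (locally_disk z Hz) as Lz.
  refine (conj _ (conj _ (conj _ _))).
  - eapply is_derive_ext_loc; [|exact D1].
    eapply filter_imp; [|exact (locally_disk_x z Hz)]; intros; simpl; auto.
  - eapply is_derive_ext_loc; [|exact D2].
    eapply filter_imp; [|exact (locally_disk_y z Hz)]; intros; simpl; auto.
  - eapply continuous_ext_loc; [|exact K1].
    eapply filter_imp; [|exact Lz]; intros; simpl; auto.
  - eapply continuous_ext_loc; [|exact K2].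
    eapply filter_imp; [|exact Lz]; intros; simpl; auto.
Qed.

Lemma continuous_slice {U V W : UniformSpace} (k : U -> V -> W) (z : U) (t : V) :
  continuous (fun p : U * V => k (fst p) (snd p)) (z, t) -> continuous (k z) t.
Proof.
  intros Hc; apply (continuous_comp_2 (fun _ => z) (fun s => s) k);
    [apply continuous_const|apply continuous_id|exact Hc].
Qed.

Lemma continuous_pair {U V W : UniformSpace} (f : U -> V) (g : U -> W) (x : U) :
  continuous f x -> continuous g x -> continuous (fun y => (f y, g y)) x.
Proof.
  intros Hf Hg; apply (continuous_comp_2 f g pair); auto.
  apply (continuous_ext (fun p => p)); [intros []; reflexivity|apply continuous_id].
Qed.

Lemma C1_turn (k kx ky : C -> R -> R) :
  (forall z t, disk z -> is_derive (fun x => k (x, snd z) t) (fst z) (kx z t)) ->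
  (forall z t, disk z -> is_derive (fun y => k (fst z, y) t) (snd z) (ky z t)) ->
  (forall z t, disk z -> continuous (fun p : C * R => kx (fst p) (snd p)) (z, t)) ->
  (forall z t, disk z -> continuous (fun p : C * R => ky (fst p) (snd p)) (z, t)) ->
  (forall z t, disk z -> continuous (k z) t) ->
  C1 (fun z => turn (k z)) (fun z => turn (kx z)) (fun z => turn (ky z)).
Proof.
  intros Dx Dy Kx Ky K z Hz; pose proof (locally_disk z Hz) as Lz.
  pose proof (locally_disk_x z Hz) as Lx; pose proof (locally_disk_y z Hz) as Ly.
  refine (conj _ (conj _ (conj _ _))).
  - replace (kx z) with (kx (fst z, snd z)) by (destruct z; reflexivity).
    apply (is_derive_turn (fun x t => k (x, snd z) t) (fun x t => kx (x, snd z) t)).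
    + eapply filter_imp; [|exact Lx]; intros x Hx t; apply (Dx (x, snd z) t Hx).
    + intros t.
      apply (continuous_comp (fun p : R * R => ((fst p, snd z) : C, snd p))
               (fun p : C * R => kx (fst p) (snd p))).
      * apply continuous_pair; [apply continuous_pair|]; cont.
      * apply (Kx (fst z, snd z)). destruct z; exact Hz.
    + eapply filter_imp; [|exact Lx]; intros x Hx t; now apply K.
  - replace (ky z) with (ky (fst z, snd z)) by (destruct z; reflexivity).
    apply (is_derive_turn (fun y t => k (fst z, y) t) (fun y t => ky (fst z, y) t)).
    + eapply filter_imp; [|exact Ly]; intros y Hy t; apply (Dy (fst z, y) t Hy).
    + intros t.
      apply (continuous_comp (fun p : R * R => ((fst z, fst p) : C, snd p))
               (fun p : C * R => ky (fst p) (snd p))).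
      * apply continuous_pair; [apply continuous_pair|]; cont.
      * apply (Ky (fst z, snd z)). destruct z; exact Hz.
    + eapply filter_imp; [|exact Ly]; intros y Hy t; now apply K.
  - apply (continuous_turn kx); [intros t; now apply Kx|].
    eapply filter_imp; [|exact Lz]; intros y Hy t; apply continuous_slice; now apply Kx.
  - apply (continuous_turn ky); [intros t; now apply Ky|].
    eapply filter_imp; [|exact Lz]; intros y Hy t; apply continuous_slice; now apply Ky.
Qed.

(** * The Poisson integral of a real function is harmonic *)

(** Real and imaginary parts of [1 / (1 - w)], [w = z exp (- i t)]. *)
Definition cauchy_den (z : C) (t : R) : R :=
  (1 - fst z * cos t - snd z * sin t) ^ 2 + (snd z * cos t - fst z * sin t) ^ 2.
Definition re1 (z : C) (t : R) : R :=
  (1 - fst z * cos t - snd z * sin t) / cauchy_den z t.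
Definition im1 (z : C) (t : R) : R :=
  (snd z * cos t - fst z * sin t) / cauchy_den z t.

(** Real and imaginary parts of [exp (- i t) / (1 - w)^2]. *)
Definition re2 (z : C) (t : R) : R :=
  (re1 z t ^ 2 - im1 z t ^ 2) * cos t + 2 * re1 z t * im1 z t * sin t.
Definition im2 (z : C) (t : R) : R :=
  2 * re1 z t * im1 z t * cos t - (re1 z t ^ 2 - im1 z t ^ 2) * sin t.

(** Real and imaginary parts of [exp (- 2 i t) / (1 - w)^3]. *)
Definition re3 (z : C) (t : R) : R :=
  re2 z t * (re1 z t * cos t + im1 z t * sin t)
  - im2 z t * (im1 z t * cos t - re1 z t * sin t).
Definition im3 (z : C) (t : R) : R :=
  re2 z t * (im1 z t * cos t - re1 z t * sin t)
  + im2 z t * (re1 z t * cos t + im1 z t * sin t).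

Lemma radial_le_Cmod (z : C) (t : R) : disk z ->
  Rabs (fst z * cos t + snd z * sin t) <= Cmod z.
Proof.
  intros Hz; rewrite <- (Rabs_pos_eq (Cmod z)) by apply Cmod_ge_0.
  apply Rsqr_le_abs_0; unfold Rsqr.
  replace (Cmod z * Cmod z) with (Cmod z ^ 2) by ring; rewrite Cmod_sq.
  assert (0 <= (fst z * sin t - snd z * cos t) ^ 2) by apply pow2_ge_0.
  pose proof (cos2_sin2 t) as CS.
  replace (fst z ^ 2 + snd z ^ 2) with
    ((fst z ^ 2 + snd z ^ 2) * (cos t ^ 2 + sin t ^ 2)) by (rewrite CS; ring).
  nra.
Qed.

Lemma cauchy_den_pos (z : C) (t : R) : disk z -> 0 < cauchy_den z t.
Proof.
  intros Hz; unfold cauchy_den; unfold disk in Hz.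
  pose proof (radial_le_Cmod z t Hz) as Hr; apply Rabs_le_between in Hr.
  assert (0 < (1 - fst z * cos t - snd z * sin t) ^ 2) by (apply pow_lt; lra).
  generalize (pow2_ge_0 (snd z * cos t - fst z * sin t)); lra.
Qed.

Lemma is_derive_re1_x z t : disk z ->
  is_derive (fun x => re1 (x, snd z) t) (fst z) (re2 z t).
Proof.
  intros Hz; pose proof (cauchy_den_pos z t Hz) as HN; destruct z as [x y].
  unfold re2, re1, im1, cauchy_den in *; simpl in *.
  auto_derive; [lra|]; field; simpl; lra.
Qed.
Lemma is_derive_im1_x z t : disk z ->
  is_derive (fun x => im1 (x, snd z) t) (fst z) (im2 z t).
Proof.
  intros Hz; pose proof (cauchy_den_pos z t Hz) as HN; destruct z as [x y].
  unfold im2, re1, im1, cauchy_den in *; simpl in *.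
  auto_derive; [lra|]; field; simpl; lra.
Qed.
Lemma is_derive_re1_y z t : disk z ->
  is_derive (fun y => re1 (fst z, y) t) (snd z) (- im2 z t).
Proof.
  intros Hz; pose proof (cauchy_den_pos z t Hz) as HN; destruct z as [x y].
  unfold im2, re1, im1, cauchy_den in *; simpl in *.
  auto_derive; [lra|]; field; simpl; lra.
Qed.
Lemma is_derive_im1_y z t : disk z ->
  is_derive (fun y => im1 (fst z, y) t) (snd z) (re2 z t).
Proof.
  intros Hz; pose proof (cauchy_den_pos z t Hz) as HN; destruct z as [x y].
  unfold re2, re1, im1, cauchy_den in *; simpl in *.
  auto_derive; [lra|]; field; simpl; lra.
Qed.

(** For the real part of [(a + i b)^2 (c - i s)]; with [(- s, c)] in place of
    [(c, s)] it serves the imaginary part. *)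
Lemma is_derive_square_times (a b : R -> R) (x a' b' c s : R) :
  is_derive a x a' -> is_derive b x b' ->
  is_derive (fun x => (a x ^ 2 - b x ^ 2) * c + 2 * a x * b x * s) x
    ((2 * a x * a' - 2 * b x * b') * c + 2 * (a' * b x + a x * b') * s).
Proof.
  intros Ha Hb; auto_derive.
  - repeat split; try (eexists; eassumption).
  - replace (Derive (fun x : R => a x) x) with a'
      by (symmetry; exact (is_derive_unique a x a' Ha)).
    replace (Derive (fun x : R => b x) x) with b'
      by (symmetry; exact (is_derive_unique b x b' Hb)).
    ring.
Qed.

Lemma is_derive_re2_x z t : disk z ->
  is_derive (fun x => re2 (x, snd z) t) (fst z) (2 * re3 z t).
Proof.
  intros Hz.
  pose proof (is_derive_square_times _ _ _ _ _ (cos t) (sin t)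
    (is_derive_re1_x z t Hz) (is_derive_im1_x z t Hz)) as D.
  destruct z as [x y]; simpl in *.
  eapply is_derive_eq; [exact D|]; unfold re3; ring.
Qed.
Lemma is_derive_im2_x z t : disk z ->
  is_derive (fun x => im2 (x, snd z) t) (fst z) (2 * im3 z t).
Proof.
  intros Hz.
  pose proof (is_derive_square_times _ _ _ _ _ (- sin t) (cos t)
    (is_derive_re1_x z t Hz) (is_derive_im1_x z t Hz)) as D.
  destruct z as [x y]; simpl in *.
  refine (is_derive_eq _ _ _ _ (is_derive_ext (V := R_NormedModule) _ _ _ _ _ D) _).
  - intros u; match goal with |- ?a = ?b => change (@eq R a b) end; unfold im2; cbv beta; ring.
  - unfold im3; ring.
Qed.
Lemma is_derive_re2_y z t : disk z ->
  is_derive (fun y => re2 (fst z, y) t) (snd z) (- 2 * im3 z t).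
Proof.
  intros Hz.
  pose proof (is_derive_square_times _ _ _ _ _ (cos t) (sin t)
    (is_derive_re1_y z t Hz) (is_derive_im1_y z t Hz)) as D.
  destruct z as [x y]; simpl in *.
  eapply is_derive_eq; [exact D|]; unfold im3; ring.
Qed.
Lemma is_derive_im2_y z t : disk z ->
  is_derive (fun y => im2 (fst z, y) t) (snd z) (2 * re3 z t).
Proof.
  intros Hz.
  pose proof (is_derive_square_times _ _ _ _ _ (- sin t) (cos t)
    (is_derive_re1_y z t Hz) (is_derive_im1_y z t Hz)) as D.
  destruct z as [x y]; simpl in *.
  refine (is_derive_eq _ _ _ _ (is_derive_ext (V := R_NormedModule) _ _ _ _ _ D) _).
  - intros u; match goal with |- ?a = ?b => change (@eq R a b) end; unfold im2; cbv beta; ring.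
  - unfold re3; ring.
Qed.

Lemma continuous_re1_im1 z t : disk z ->
  continuous (fun p : C * R => re1 (fst p) (snd p)) (z, t) /\
  continuous (fun p : C * R => im1 (fst p) (snd p)) (z, t).
Proof.
  intros Hz; pose proof (cauchy_den_pos z t Hz) as HN.
  unfold re1, im1, cauchy_den in *.
  split; cont; simpl in *; lra.
Qed.

Lemma continuous_re2_im2 z t : disk z ->
  continuous (fun p : C * R => re2 (fst p) (snd p)) (z, t) /\
  continuous (fun p : C * R => im2 (fst p) (snd p)) (z, t).
Proof.
  intros Hz; destruct (continuous_re1_im1 z t Hz) as [K1 K2].
  unfold re2, im2; split; cont.
Qed.

Lemma continuous_re3_im3 z t : disk z ->
  continuous (fun p : C * R => re3 (fst p) (snd p)) (z, t) /\
  continuous (fun p : C * R => im3 (fst p) (snd p)) (z, t).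
Proof.
  intros Hz; destruct (continuous_re1_im1 z t Hz) as [K1 K2].
  destruct (continuous_re2_im2 z t Hz) as [K3 K4].
  unfold re3, im3; split; cont.
Qed.

Lemma poisson_kernel_re1 z t : disk z -> poisson_kernel z t = 2 * re1 z t - 1.
Proof.
  intros Hz; pose proof (cauchy_den_pos z t Hz) as HN.
  assert (E : 1 - 2 * (fst z * cos t + snd z * sin t) + Cmod z ^ 2 = cauchy_den z t).
  { rewrite Cmod_sq; unfold cauchy_den; pose proof (cos2_sin2 t) as CS.
    replace (fst z ^ 2 + snd z ^ 2) with
      ((fst z ^ 2 + snd z ^ 2) * (cos t ^ 2 + sin t ^ 2)) by (rewrite CS; ring).
    ring. }
  unfold poisson_kernel, re1; rewrite E.
  apply Rmult_eq_reg_r with (cauchy_den z t); [|lra].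
  field_simplify; try lra.
Qed.

Lemma continuous_poisson_kernel z t : disk z -> continuous (poisson_kernel z) t.
Proof.
  intros Hz; apply (continuous_ext (fun t => 2 * re1 z t - 1)).
  - intros s; symmetry; now apply poisson_kernel_re1.
  - assert (K : continuous (re1 z) t)
      by (apply continuous_slice; now apply continuous_re1_im1).
    cont.
Qed.

Lemma is_derive_Rmult_const (f : R -> R) (x l c : R) :
  is_derive f x l -> is_derive (fun x => f x * c) x (l * c).
Proof. exact (is_derive_scal_l (V := R_NormedModule) f x l c). Qed.

Lemma is_derive_const_Rmult (f : R -> R) (x l c : R) :
  is_derive f x l -> is_derive (fun x => c * f x) x (c * l).
Proof. exact (is_derive_scal f x c l). Qed.

Lemma C1_const_Rmult (c : R) (f fx fy : C -> R) :
  C1 f fx fy -> C1 (fun z => c * f z) (fun z => c * fx z) (fun z => c * fy z).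
Proof.
  intros Hf z Hz; destruct (Hf z Hz) as (D1 & D2 & K1 & K2).
  refine (conj _ (conj _ (conj _ _))).
  - now apply is_derive_const_Rmult.
  - now apply is_derive_const_Rmult.
  - cont.
  - cont.
Qed.

Lemma C1_turn_density (k kx ky : C -> R -> R) (g : R -> R) :
  (forall t, continuous g t) ->
  (forall z t, disk z -> is_derive (fun x => k (x, snd z) t) (fst z) (kx z t)) ->
  (forall z t, disk z -> is_derive (fun y => k (fst z, y) t) (snd z) (ky z t)) ->
  (forall z t, disk z -> continuous (fun p : C * R => k (fst p) (snd p)) (z, t)) ->
  (forall z t, disk z -> continuous (fun p : C * R => kx (fst p) (snd p)) (z, t)) ->
  (forall z t, disk z -> continuous (fun p : C * R => ky (fst p) (snd p)) (z, t)) ->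
  C1 (fun z => turn (fun t => k z t * g t)) (fun z => turn (fun t => kx z t * g t))
     (fun z => turn (fun t => ky z t * g t)).
Proof.
  intros Hg Dx Dy K Kx Ky.
  assert (G : forall z t, continuous (fun p : C * R => g (snd p)) (z, t)).
  { intros z t; apply (continuous_comp snd g); [apply continuous_snd|apply Hg]. }
  apply (C1_turn (fun z t => k z t * g t) (fun z t => kx z t * g t)
           (fun z t => ky z t * g t)); intros z t Hz.
  - apply is_derive_Rmult_const; auto.
  - apply is_derive_Rmult_const; auto.
  - apply continuous_Rmult; auto.
  - apply continuous_Rmult; auto.
  - apply continuous_Rmult; [|apply Hg]. apply continuous_slice; auto.
Qed.

Definition poissonR (g : R -> R) (z : C) : R :=
  / (2 * PI) * turn (fun t => poisson_kernel z t * g t).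

Notation harmonicR := (harmonic_on_disk (H := R_CompleteNormedModule)).

(** The kernel is [Re (2 / (1 - w) - 1)], the real part of a holomorphic
    function of [z]; its derivatives are those of the Cauchy kernels. *)
Lemma poissonR_C1 (g : R -> R) : (forall t, continuous g t) ->
  C1 (poissonR g) (fun z => / (2 * PI) * turn (fun t => 2 * re2 z t * g t))
     (fun z => / (2 * PI) * turn (fun t => -2 * im2 z t * g t)).
Proof.
  intros Hg.
  eapply C1_on_disk_ext; [|reflexivity|reflexivity|].
  2: { apply C1_const_Rmult, (C1_turn_density (fun z t => 2 * re1 z t - 1)
         (fun z t => 2 * re2 z t) (fun z t => -2 * im2 z t)); auto;
       intros z t Hz;
       destruct (continuous_re1_im1 z t Hz); destruct (continuous_re2_im2 z t Hz);
       try cont.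
       - refine (is_derive_eq _ _ _ _ (is_derive_minus (V := R_NormedModule) _ _ _ _ _
           (is_derive_const_Rmult _ _ _ 2 (is_derive_re1_x z t Hz))
           (is_derive_const 1 _)) _).
         change (2 * re2 z t - 0 = 2 * re2 z t); ring.
       - refine (is_derive_eq _ _ _ _ (is_derive_minus (V := R_NormedModule) _ _ _ _ _
           (is_derive_const_Rmult _ _ _ 2 (is_derive_re1_y z t Hz))
           (is_derive_const 1 _)) _).
         change (2 * (- im2 z t) - 0 = -2 * im2 z t); ring. }
  intros z Hz; unfold poissonR; f_equal; apply turn_ext; intros t.
  now rewrite poisson_kernel_re1.
Qed.

Lemma poissonR_harmonic (g : R -> R) :
  (forall t, continuous g t) -> harmonicR (poissonR g).
Proof.
  intros Hg.
  set (c := / (2 * PI)).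
  set (I := fun (k : C -> R -> R) z => c * turn (fun t => k z t * g t)).
  exists (I (fun z t => 2 * re2 z t)), (I (fun z t => -2 * im2 z t)),
         (I (fun z t => 4 * re3 z t)), (I (fun z t => -4 * im3 z t)),
         (I (fun z t => -4 * im3 z t)), (I (fun z t => -4 * re3 z t)).
  split; [|split; [|split]].
  - now apply poissonR_C1.
  - apply C1_const_Rmult, C1_turn_density; auto; intros z t Hz;
      destruct (continuous_re3_im3 z t Hz); destruct (continuous_re2_im2 z t Hz);
      try cont.
    + refine (is_derive_eq _ _ _ _ (is_derive_const_Rmult _ _ _ 2
        (is_derive_re2_x z t Hz)) _); ring.
    + refine (is_derive_eq _ _ _ _ (is_derive_const_Rmult _ _ _ 2
        (is_derive_re2_y z t Hz)) _); ring.
  - apply C1_const_Rmult, C1_turn_density; auto; intros z t Hz;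
      destruct (continuous_re3_im3 z t Hz); destruct (continuous_re2_im2 z t Hz);
      try cont.
    + refine (is_derive_eq _ _ _ _ (is_derive_const_Rmult _ _ _ (-2)
        (is_derive_im2_x z t Hz)) _); ring.
    + refine (is_derive_eq _ _ _ _ (is_derive_const_Rmult _ _ _ (-2)
        (is_derive_im2_y z t Hz)) _); ring.
  - intros z Hz; unfold I.
    assert (K : forall t, continuous (fun t => re3 z t * g t) t).
    { intros t; apply continuous_Rmult; [|auto].
      apply continuous_slice; now apply continuous_re3_im3. }
    rewrite (turn_ext (fun t => 4 * re3 z t * g t) (fun t => 4 * (re3 z t * g t)))
      by (intros; ring).
    rewrite (turn_ext (fun t => -4 * re3 z t * g t) (fun t => -4 * (re3 z t * g t)))
      by (intros; ring).
    rewrite !turn_scal by exact K.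
    change (c * (4 * turn (fun t => re3 z t * g t)) +
            c * (-4 * turn (fun t => re3 z t * g t)) = 0); ring.
Qed.

(** The primitive is [t + 2 arg (1 - w)], and [1 - w] stays in the right
    half-plane. *)
Lemma turn_poisson_kernel (z : C) : disk z -> turn (poisson_kernel z) = 2 * PI.
Proof.
  intros Hz.
  pose (p := fun t => 1 - fst z * cos t - snd z * sin t).
  pose (q := fun t => snd z * cos t - fst z * sin t).
  assert (Hp : forall t, 0 < p t).
  { intros t; unfold p; generalize (radial_le_Cmod z t Hz); intros H.
    apply Rabs_le_between in H; unfold disk in Hz; lra. }
  rewrite (turn_ext _ (fun t => 2 * re1 z t - 1))
    by (intros; now apply poisson_kernel_re1).
  rewrite (turn_derive (fun t => t - 2 * atan (q t / p t))).
  - unfold p, q; rewrite sin_2PI, cos_2PI, sin_0, cos_0; ring.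
  - intros t; pose proof (Hp t) as P; pose proof (cauchy_den_pos z t Hz) as HN.
    pose proof (cos2_sin2 t) as CS.
    unfold p, q, re1, cauchy_den in *.
    auto_derive; [lra|]; field; simpl in *; lra.
  - assert (K : forall t, continuous (re1 z) t)
      by (intros; apply continuous_slice; now apply continuous_re1_im1).
    cont.
Qed.

(** * Harmonic functions on concentric circles *)

Definition pt (r t : R) : C := (r * cos t, r * sin t).

Lemma disk_pt (r t : R) : Rabs r < 1 -> disk (pt r t).
Proof.
  intros Hr; apply disk_iff; simpl fst; simpl snd.
  replace ((r * cos t) ^ 2 + (r * sin t) ^ 2) with (r ^ 2 * (cos t ^ 2 + sin t ^ 2)) by ring.
  rewrite cos2_sin2; apply Rabs_def2 in Hr; nra.
Qed.

Lemma locally_Rabs_lt (r : R) : Rabs r < 1 -> locally r (fun s => Rabs s < 1).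
Proof.
  intros Hr.
  assert (Hc : continuous Rabs r) by apply continuous_Rabs.
  exact (Hc _ (open_lt 1 _ Hr)).
Qed.

Lemma C1_differentiable (f fx fy : C -> R) (x y : R) : C1 f fx fy -> disk (x, y) ->
  differentiable_pt_lim (fun u v => f (u, v)) x y (fx (x, y)) (fy (x, y)).
Proof.
  intros Hf Hz; apply filterdiff_differentiable_pt_lim.
  apply (is_derive_filterdiff (fun u v => f (u, v)) x y (fun u v => fx (u, v))).
  - eapply filter_imp; [|exact (locally_disk (x, y) Hz)].
    intros u Hu; destruct (Hf u Hu) as (D1 & _); destruct u; exact D1.
  - destruct (Hf _ Hz) as (_ & D2 & _); exact D2.
  - destruct (Hf _ Hz) as (_ & _ & K & _).
    apply (continuous_ext fx); [intros []; reflexivity|exact K].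
Qed.

Lemma C1_continuous (f fx fy : C -> R) (z : C) : C1 f fx fy -> disk z -> continuous f z.
Proof.
  intros Hf Hz; destruct z as [x y].
  assert (Hc : continuity_2d_pt (fun u v => f (u, v)) x y).
  { apply differentiable_continuity_pt.
    eexists; eexists; apply (C1_differentiable f fx fy x y Hf Hz). }
  apply continuity_2d_pt_filterlim in Hc.
  apply (continuous_ext (fun z : R * R => f (fst z, snd z)));
    [intros []; reflexivity|exact Hc].
Qed.

Lemma C1_curve (f fx fy : C -> R) (x y : R -> R) (s x' y' : R) :
  C1 f fx fy -> disk (x s, y s) -> is_derive x s x' -> is_derive y s y' ->
  is_derive (fun s => f (x s, y s)) s (fx (x s, y s) * x' + fy (x s, y s) * y').
Proof.
  intros Hf Hz Hx Hy; apply is_derive_Reals.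
  apply (derivable_pt_lim_comp_2d (fun u v => f (u, v)) x y).
  - now apply C1_differentiable.
  - now apply is_derive_Reals.
  - now apply is_derive_Reals.
Qed.

Lemma C1_mult (f fx fy g gx gy : C -> R) : C1 f fx fy -> C1 g gx gy ->
  C1 (fun z => f z * g z) (fun z => fx z * g z + f z * gx z)
     (fun z => fy z * g z + f z * gy z).
Proof.
  intros Hf Hg z Hz.
  pose proof (C1_continuous _ _ _ z Hf Hz) as Kf.
  pose proof (C1_continuous _ _ _ z Hg Hz) as Kg.
  destruct (Hf z Hz) as (D1 & D2 & K1 & K2); destruct (Hg z Hz) as (E1 & E2 & K3 & K4).
  refine (conj _ (conj _ (conj _ _))); [| |cont|cont].
  - destruct z; apply (is_derive_mult _ _ _ _ _ D1 E1); intros; apply Rmult_comm.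
  - destruct z; apply (is_derive_mult _ _ _ _ _ D2 E2); intros; apply Rmult_comm.
Qed.

Lemma C1_plus (f fx fy g gx gy : C -> R) : C1 f fx fy -> C1 g gx gy ->
  C1 (fun z => f z + g z) (fun z => fx z + gx z) (fun z => fy z + gy z).
Proof.
  intros Hf Hg z Hz.
  destruct (Hf z Hz) as (D1 & D2 & K1 & K2); destruct (Hg z Hz) as (E1 & E2 & K3 & K4).
  refine (conj _ (conj _ (conj _ _))); [| |cont|cont].
  - exact (is_derive_plus _ _ _ _ _ D1 E1).
  - exact (is_derive_plus _ _ _ _ _ D2 E2).
Qed.

Lemma C1_fst : C1 (fun z => fst z) (fun _ => 1) (fun _ => 0).
Proof.
  intros z Hz; refine (conj _ (conj _ (conj _ _))); [| |cont|cont]; simpl.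
  - apply (is_derive_id (K := R_AbsRing)).
  - apply (is_derive_const (V := R_NormedModule)).
Qed.

Lemma C1_snd : C1 (fun z => snd z) (fun _ => 0) (fun _ => 1).
Proof.
  intros z Hz; refine (conj _ (conj _ (conj _ _))); [| |cont|cont]; simpl.
  - apply (is_derive_const (V := R_NormedModule)).
  - apply (is_derive_id (K := R_AbsRing)).
Qed.

(** In polar coordinates, [r df/dr] and [df/dt]. *)
Definition radial (fx fy : C -> R) (z : C) : R := fst z * fx z + snd z * fy z.
Definition angular (fx fy : C -> R) (z : C) : R := fst z * fy z - snd z * fx z.

Lemma C1_radial (fx fy fxx fxy fyx fyy : C -> R) : C1 fx fxx fxy -> C1 fy fyx fyy ->
  C1 (radial fx fy) (fun z => fx z + fst z * fxx z + snd z * fyx z)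
     (fun z => fy z + fst z * fxy z + snd z * fyy z).
Proof.
  intros Hx Hy.
  eapply C1_on_disk_ext; [| | |exact (C1_plus _ _ _ _ _ _
    (C1_mult _ _ _ _ _ _ C1_fst Hx) (C1_mult _ _ _ _ _ _ C1_snd Hy))];
  intros z _; unfold radial; simpl; ring.
Qed.

Lemma C1_angular (fx fy fxx fxy fyx fyy : C -> R) : C1 fx fxx fxy -> C1 fy fyx fyy ->
  C1 (angular fx fy) (fun z => fy z + fst z * fyx z - snd z * fxx z)
     (fun z => - fx z + fst z * fyy z - snd z * fxy z).
Proof.
  intros Hx Hy.
  eapply C1_on_disk_ext; [| | |exact (C1_plus _ _ _ _ _ _
    (C1_mult _ _ _ _ _ _ C1_fst Hy) (C1_const_Rmult (-1) _ _ _ (C1_mult _ _ _ _ _ _ C1_snd Hx)))];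
  intros z _; unfold angular; simpl; ring.
Qed.

Lemma continuous_on_circle (f : C -> R) (r t : R) :
  (forall z, disk z -> continuous f z) -> Rabs r < 1 ->
  continuous (fun s => f (pt r s)) t.
Proof.
  intros Hf Hr; apply (continuous_comp (pt r) f).
  - apply continuous_pair; cont.
  - now apply Hf, disk_pt.
Qed.

Lemma continuous_on_circles (f : C -> R) (r t : R) :
  (forall z, disk z -> continuous f z) -> Rabs r < 1 ->
  continuous (fun p : R * R => f (pt (fst p) (snd p))) (r, t).
Proof.
  intros Hf Hr; apply (continuous_comp (fun p : R * R => pt (fst p) (snd p)) f).
  - apply continuous_pair; cont.
  - now apply Hf, disk_pt.
Qed.

Lemma circle_derive (f fx fy : C -> R) (h : R -> R) (r : R) :
  C1 f fx fy -> (forall t, continuous h t) -> Rabs r < 1 ->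
  is_derive (fun r => turn (fun t => f (pt r t) * h t)) r
    (turn (fun t => (fx (pt r t) * cos t + fy (pt r t) * sin t) * h t)).
Proof.
  intros Hf Hh Hr.
  assert (Kf : forall z, disk z -> continuous f z)
    by (intros; now apply (C1_continuous f fx fy)).
  assert (Kx : forall z, disk z -> continuous fx z) by (intros z Hz; now apply Hf).
  assert (Ky : forall z, disk z -> continuous fy z) by (intros z Hz; now apply Hf).
  apply (is_derive_turn (fun r t => f (pt r t) * h t)
    (fun r t => (fx (pt r t) * cos t + fy (pt r t) * sin t) * h t)).
  - eapply filter_imp; [|exact (locally_Rabs_lt r Hr)].
    intros s Hs t; apply is_derive_Rmult_const.
    apply (C1_curve f fx fy (fun s => s * cos t) (fun s => s * sin t)); auto.
    + now apply disk_pt.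
    + auto_derive; auto; ring.
    + auto_derive; auto; ring.
  - intros t.
    pose proof (continuous_on_circles fx r t Kx Hr) as C1'.
    pose proof (continuous_on_circles fy r t Ky Hr) as C2'.
    assert (C3 : continuous (fun p : R * R => h (snd p)) (r, t)).
    { apply (continuous_comp snd h); [apply continuous_snd|apply Hh]. }
    cont.
  - eapply filter_imp; [|exact (locally_Rabs_lt r Hr)].
    intros s Hs t; apply continuous_Rmult; [now apply continuous_on_circle|apply Hh].
Qed.

(** The rotation field of [f] is the derivative of [f] along the circle. *)
Lemma circle_parts (f fx fy : C -> R) (h h' : R -> R) (r : R) :
  C1 f fx fy -> (forall t, is_derive h t (h' t)) -> (forall t, continuous h' t) ->
  h (2 * PI) = h 0 -> Rabs r < 1 ->
  turn (fun t => angular fx fy (pt r t) * h t) = - turn (fun t => f (pt r t) * h' t).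
Proof.
  intros Hf Hd Hh' Hp Hr.
  assert (Hh : forall t, continuous h t).
  { intros t; apply (ex_derive_continuous h); eexists; apply Hd. }
  assert (Kf : forall z, disk z -> continuous f z)
    by (intros; now apply (C1_continuous f fx fy)).
  assert (Kx : forall z, disk z -> continuous fx z) by (intros z Hz; now apply Hf).
  assert (Ky : forall z, disk z -> continuous fy z) by (intros z Hz; now apply Hf).
  assert (Ka : forall z, disk z -> continuous (angular fx fy) z).
  { intros z Hz; specialize (Kx z Hz); specialize (Ky z Hz); unfold angular; cont. }
  pose proof (fun t => continuous_on_circle _ r t Kf Hr) as C1'.
  pose proof (fun t => continuous_on_circle _ r t Ka Hr) as C2'.
  enough (E : turn (fun t => angular fx fy (pt r t) * h t + f (pt r t) * h' t) = 0).
  { rewrite turn_plus in E by (intros; apply continuous_Rmult; auto). lra. }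
  rewrite (turn_derive (fun t => f (pt r t) * h t)).
  - unfold pt; rewrite cos_2PI, sin_2PI, cos_0, sin_0, Hp; ring.
  - intros t; refine (is_derive_eq _ _ _ _ (is_derive_mult _ _ _ _ _
      (C1_curve f fx fy (fun t => r * cos t) (fun t => r * sin t) t
        (r * - sin t) (r * cos t) Hf _ _ _) (Hd t) _) _).
    + now apply disk_pt.
    + auto_derive; auto; ring.
    + auto_derive; auto; ring.
    + intros; apply Rmult_comm.
    + unfold angular; simpl fst; simpl snd; change (mult ?a ?b) with (a * b).
      change (plus ?a ?b) with (a + b). unfold pt; simpl; ring.
  - intros t; apply continuous_Rplus; apply continuous_Rmult; auto.
Qed.

Lemma eq_of_derive_0 (f df : R -> R) (a b : R) : a < b ->
  (forall x, a <= x <= b -> is_derive f x (df x)) ->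
  (forall x, a < x < b -> df x = 0) -> f a = f b.
Proof.
  intros Hab Hd H0.
  destruct (MVT_cor2 f df a b Hab) as [c [Ec Hc]].
  - intros c Hc; now apply is_derive_Reals, Hd.
  - rewrite (H0 c Hc) in Ec; lra.
Qed.

Lemma le_of_derive_ge_0 (f df : R -> R) (a b : R) : a < b ->
  (forall x, a <= x <= b -> is_derive f x (df x)) ->
  (forall x, a < x < b -> 0 <= df x) -> f a <= f b.
Proof.
  intros Hab Hd H0.
  destruct (MVT_cor2 f df a b Hab) as [c [Ec Hc]].
  - intros c Hc; now apply is_derive_Reals, Hd.
  - specialize (H0 c Hc); nra.
Qed.

Section Harmonic.
Variables f fx fy fxx fxy fyx fyy : C -> R.
Hypothesis Hf : C1 f fx fy.
Hypothesis Hfx : C1 fx fxx fxy.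
Hypothesis Hfy : C1 fy fyx fyy.
Hypothesis Hlap : forall z, disk z -> fxx z + fyy z = 0.

Let E := radial fx fy.
Let T := angular fx fy.
Let Ex := fun z : C => fx z + fst z * fxx z + snd z * fyx z.
Let Ey := fun z : C => fy z + fst z * fxy z + snd z * fyy z.
Let Tx := fun z : C => fy z + fst z * fyx z - snd z * fxx z.
Let Ty := fun z : C => - fx z + fst z * fyy z - snd z * fxy z.

(** Laplace's equation in polar form, [(r d/dr)^2 f = - (d/dt)^2 f]. *)
Lemma radial_radial z : disk z -> radial Ex Ey z = - angular Tx Ty z.
Proof.
  intros Hz; unfold radial, angular, Ex, Ey, Tx, Ty.
  replace (fyy z) with (- fxx z) by (generalize (Hlap z Hz); lra). ring.
Qed.

Lemma radial_pt gx gy r t :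
  radial gx gy (pt r t) = r * (gx (pt r t) * cos t + gy (pt r t) * sin t).
Proof. unfold radial; simpl fst; simpl snd; ring. Qed.

Let KC1 {g gx gy} (H : C1 g gx gy) z (Hz : disk z) : continuous g z :=
  C1_continuous g gx gy z H Hz.

Lemma continuous_circle_C1 {g gx gy} (H : C1 g gx gy) r (Hr : Rabs r < 1) t :
  continuous (fun s => g (pt r s)) t.
Proof. apply continuous_on_circle; [intros z Hz; exact (KC1 H z Hz)|exact Hr]. Qed.

(** The case of interest is [h = cos] or [h = sin].  Put [c(r)] for the integral of
    [f(r exp (i t)) h(t)] and [s(r) = r c'(r)].  Laplace's equation gives
    [r s' = c], so [r (c - s)] is constant, hence zero: [r c' = c], that is, [c'] is
    constant. *)
Lemma first_moment (h h' : R -> R) (r : R) :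
  (forall t, is_derive h t (h' t)) -> (forall t, is_derive h' t (- h t)) ->
  h (2 * PI) = h 0 -> h' (2 * PI) = h' 0 -> 0 < r < 1 ->
  turn (fun t => f (pt r t) * h t) =
  r * (fx (RtoC 0) * turn (fun t => cos t * h t) + fy (RtoC 0) * turn (fun t => sin t * h t)).
Proof.
  intros Dh Dh' Ph Ph' Hr.
  assert (Hh : forall t, continuous h t)
    by (intros t; apply (ex_derive_continuous h); eexists; apply Dh).
  assert (Hh' : forall t, continuous h' t)
    by (intros t; apply (ex_derive_continuous h'); eexists; apply Dh').
  assert (Hnh : forall t, continuous (fun t => - h t) t) by cont.
  pose proof (C1_radial fx fy fxx fxy fyx fyy Hfx Hfy) as HE; fold E Ex Ey in HE.
  pose proof (C1_angular fx fy fxx fxy fyx fyy Hfx Hfy) as HT; fold T Tx Ty in HT.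
  set (c := fun r => turn (fun t => f (pt r t) * h t)).
  set (k := fun r => turn (fun t => (fx (pt r t) * cos t + fy (pt r t) * sin t) * h t)).
  set (s := fun r => turn (fun t => E (pt r t) * h t)).
  set (s' := fun r => turn (fun t => (Ex (pt r t) * cos t + Ey (pt r t) * sin t) * h t)).
  assert (Dc : forall r, Rabs r < 1 -> is_derive c r (k r))
    by (intros; now apply circle_derive).
  assert (Ds : forall r, Rabs r < 1 -> is_derive s r (s' r))
    by (intros; now apply circle_derive).
  assert (Esk : forall r, Rabs r < 1 -> s r = r * k r).
  { intros q Hq; unfold s, k.
    pose proof (continuous_circle_C1 Hfx q Hq). pose proof (continuous_circle_C1 Hfy q Hq).
    rewrite <- turn_scal by cont.
    apply turn_ext; intros t; unfold E; rewrite radial_pt; ring. }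
  assert (Esc : forall r, Rabs r < 1 -> r * s' r = c r).
  { intros q Hq; unfold s', c.
    assert (KEx : forall t, continuous (fun s => Ex (pt q s)) t).
    { intros t; apply (continuous_on_circle Ex); [|exact Hq]. intros z Hz; now apply HE. }
    assert (KEy : forall t, continuous (fun s => Ey (pt q s)) t).
    { intros t; apply (continuous_on_circle Ey); [|exact Hq]. intros z Hz; now apply HE. }
    rewrite <- turn_scal by cont.
    rewrite (turn_ext _ (fun t => -1 * (angular Tx Ty (pt q t) * h t))).
    2: { intros t; transitivity (radial Ex Ey (pt q t) * h t).
         - rewrite radial_pt; ring.
         - rewrite radial_radial by now apply disk_pt. ring. }
    rewrite turn_scal.
    2: { intros t; apply continuous_Rmult; [|apply Hh].
         apply (continuous_on_circle (angular Tx Ty)); [|exact Hq].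
         intros z Hz; destruct (HT z Hz) as (_ & _ & K1 & K2); unfold angular; cont. }
    rewrite (circle_parts T Tx Ty h h') by auto.
    unfold T; rewrite (circle_parts f fx fy h' (fun t => - h t)) by auto.
    rewrite (turn_ext _ (fun t => -1 * (f (pt q t) * h t))) by (intros; ring).
    pose proof (continuous_circle_C1 Hf q Hq).
    rewrite turn_scal by cont. ring. }
  assert (Z : forall r, 0 < r < 1 -> c r = s r).
  { intros q Hq.
    assert (Z : 0 * (c 0 - s 0) = q * (c q - s q)).
    { apply (eq_of_derive_0 (fun x => x * (c x - s x))
        (fun x => 1 * (c x - s x) + x * (k x - s' x))); [lra| |].
      - intros x Hx; assert (Hx' : Rabs x < 1) by (apply Rabs_def1; lra).
        apply (is_derive_mult (fun x => x) (fun x => c x - s x)).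
        + apply (is_derive_id (K := R_AbsRing)).
        + apply (is_derive_minus (V := R_NormedModule) c s); auto.
        + intros; apply Rmult_comm.
      - intros x Hx; assert (Hx' : Rabs x < 1) by (apply Rabs_def1; lra).
        generalize (Esk x Hx') (Esc x Hx'); intros. lra. }
    assert (Z' : q * (c q - s q) = 0) by lra.
    apply Rmult_integral in Z'; destruct Z'; lra. }
  set (k1 := fun r => turn (fun t => fx (pt r t) * (cos t * h t))).
  set (k2 := fun r => turn (fun t => fy (pt r t) * (sin t * h t))).
  set (k1' := fun r => turn (fun t => (fxx (pt r t) * cos t + fxy (pt r t) * sin t) * (cos t * h t))).
  set (k2' := fun r => turn (fun t => (fyx (pt r t) * cos t + fyy (pt r t) * sin t) * (sin t * h t))).
  assert (Ek : forall r, Rabs r < 1 -> k r = k1 r + k2 r).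
  { intros q Hq; unfold k, k1, k2.
    pose proof (continuous_circle_C1 Hfx q Hq). pose proof (continuous_circle_C1 Hfy q Hq).
    rewrite <- turn_plus by cont. apply turn_ext; intros; ring. }
  assert (Dk : forall r, Rabs r < 1 -> is_derive k r (k1' r + k2' r)).
  { intros q Hq; apply (is_derive_ext_loc (fun x => k1 x + k2 x)).
    - eapply filter_imp; [|exact (locally_Rabs_lt q Hq)]. intros; now rewrite Ek.
    - apply (is_derive_plus (V := R_NormedModule) k1 k2); 
      (apply circle_derive; [assumption|cont|assumption]). }
  assert (Zk : k 0 = k r).
  { apply (eq_of_derive_0 k (fun x => k1' x + k2' x)); [lra| |].
    - intros x Hx; apply Dk, Rabs_def1; lra.
    - intros x Hx; assert (Hx' : Rabs x < 1) by (apply Rabs_def1; lra).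
      assert (D1 : is_derive c x (1 * k x + x * (k1' x + k2' x))).
      { apply (is_derive_ext_loc (fun x => x * k x)).
        - assert (Lx : locally x (fun y => 0 < y < 1)).
          { apply filter_and; [apply (open_gt 0 x)|apply (open_lt 1 x)]; lra. }
          eapply filter_imp; [|exact Lx]; intros y Hy.
          rewrite Z by auto. rewrite Esk; [reflexivity|apply Rabs_def1; lra].
        - apply (is_derive_mult (fun x => x) k); [|auto|intros; apply Rmult_comm].
          apply (is_derive_id (K := R_AbsRing)). }
      pose proof (is_derive_unique c x _ D1) as U1.
      pose proof (is_derive_unique c x _ (Dc x Hx')) as U2.
      assert (x * (k1' x + k2' x) = 0) as Z' by lra.
      apply Rmult_integral in Z'; destruct Z'; lra. }
  change (c r = r * (fx (RtoC 0) * turn (fun t => cos t * h t)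
                     + fy (RtoC 0) * turn (fun t => sin t * h t))).
  rewrite Z by auto. rewrite Esk by (apply Rabs_def1; lra). rewrite <- Zk.
  f_equal; rewrite Ek by (rewrite Rabs_R0; lra). unfold k1, k2.
  assert (P0 : forall t, pt 0 t = RtoC 0) by (intros; unfold pt, RtoC; f_equal; ring).
  rewrite (turn_ext (fun t => fx (pt 0 t) * (cos t * h t)) (fun t => fx (RtoC 0) * (cos t * h t)))
    by (intros; now rewrite P0).
  rewrite (turn_ext (fun t => fy (pt 0 t) * (sin t * h t)) (fun t => fy (RtoC 0) * (sin t * h t)))
    by (intros; now rewrite P0).
  rewrite !turn_scal by cont. reflexivity.
Qed.

(** Let [M(r)] be the integral of [f^2] and [N(r)] that of [f r f_r], so that
    [r M' = 2 N].  By Laplace's equation [r N'] is the integral of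
    [(r f_r)^2 + (f_t)^2], so [N] increases from [N(0) = 0]. *)
Lemma square_mean_increasing (r r' : R) : 0 < r < r' -> r' < 1 ->
  turn (fun t => f (pt r t) ^ 2) <= turn (fun t => f (pt r' t) ^ 2).
Proof.
  intros Hr Hr'.
  pose proof (C1_radial fx fy fxx fxy fyx fyy Hfx Hfy) as HE; fold E Ex Ey in HE.
  pose proof (C1_angular fx fy fxx fxy fyx fyy Hfx Hfy) as HT; fold T Tx Ty in HT.
  pose proof (C1_mult _ _ _ _ _ _ Hf Hf) as Hff.
  pose proof (C1_mult _ _ _ _ _ _ Hf HE) as HfE.
  pose proof (C1_mult _ _ _ _ _ _ Hf HT) as HfT.
  assert (K1 : forall t, continuous (fun _ : R => 1) t) by cont.
  set (N := fun r => turn (fun t => f (pt r t) * E (pt r t) * 1)).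
  pose proof (fun r Hr => circle_derive _ _ _ (fun _ => 1) r HfE K1 Hr) as DN.
  pose proof (fun r Hr => circle_derive _ _ _ (fun _ => 1) r Hff K1 Hr) as DM.
  cbv beta in DN, DM.
  assert (PN : forall q, 0 < q < 1 -> 0 <= N q).
  { intros q Hq.
    assert (N0 : N 0 = 0).
    { unfold N; rewrite (turn_ext _ (fun _ => 0)); [rewrite turn_const; ring|].
      intros t; unfold E; rewrite radial_pt; ring. }
    rewrite <- N0.
    eapply (le_of_derive_ge_0 N _ 0 q); [lra| |].
    - intros x Hx; apply DN, Rabs_def1; lra.
    - intros x Hx; assert (Hx' : Rabs x < 1) by (apply Rabs_def1; lra).
      cbv beta.
      match goal with |- 0 <= ?A => cut (0 <= x * A) end.
      { intros Hxx. apply Rmult_le_reg_l with x; lra. }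
      pose proof (continuous_circle_C1 Hfx x Hx') as KKx.
      pose proof (continuous_circle_C1 Hfy x Hx') as KKy.
      pose proof (continuous_circle_C1 Hf x Hx') as KKf.
      pose proof (continuous_circle_C1 HE x Hx') as KKE.
      pose proof (continuous_circle_C1 HT x Hx') as KKT.
      assert (KEx : forall t, continuous (fun s => Ex (pt x s)) t).
      { intros t; apply (continuous_on_circle Ex); [|exact Hx']. intros z Hz; now apply HE. }
      assert (KEy : forall t, continuous (fun s => Ey (pt x s)) t).
      { intros t; apply (continuous_on_circle Ey); [|exact Hx']. intros z Hz; now apply HE. }
      assert (KTT : forall t, continuous (fun s => angular Tx Ty (pt x s)) t).
      { intros t; apply (continuous_on_circle (angular Tx Ty)); [|exact Hx'].
        intros z Hz; destruct (HT z Hz) as (_ & _ & K3 & K4); unfold angular; cont. }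
      rewrite <- turn_scal by cont.
      rewrite (turn_ext _ (fun t => (E (pt x t) ^ 2 + T (pt x t) ^ 2)
        - angular (fun z => fx z * T z + f z * Tx z) (fun z => fy z * T z + f z * Ty z) (pt x t) * 1)).
      2: { intros t.
           transitivity (E (pt x t) ^ 2 + f (pt x t) * radial Ex Ey (pt x t)).
           - unfold E; rewrite !radial_pt; ring.
           - rewrite radial_radial by now apply disk_pt.
             unfold T, angular; simpl fst; simpl snd; ring. }
      rewrite turn_minus; [|cont|].
      + rewrite (circle_parts _ _ _ (fun _ => 1) (fun _ => 0) x HfT); auto.
        * rewrite (turn_ext (fun t => f (pt x t) * T (pt x t) * 0) (fun _ => 0))
            by (intros; ring).
          rewrite turn_const.
          assert (0 <= turn (fun t => E (pt x t) ^ 2 + T (pt x t) ^ 2)); [|lra].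
          apply turn_ge_0; [cont|]. intros t.
          generalize (pow2_ge_0 (E (pt x t))) (pow2_ge_0 (T (pt x t))); lra.
        * intros; apply (is_derive_const (V := R_NormedModule)).
        * cont.
      + intros t0; apply (continuous_ext (fun t => (T (pt x t) ^ 2 + f (pt x t) * angular Tx Ty (pt x t)))).
        * intros t; match goal with |- ?a = ?b => change (@eq R a b) end.
          unfold T, angular; simpl fst; simpl snd; ring.
        * cont. }
  set (M := fun r => turn (fun t => f (pt r t) * f (pt r t) * 1)).
  assert (EM : forall r, turn (fun t => f (pt r t) ^ 2) = M r)
    by (intros; apply turn_ext; intros; ring).
  rewrite !EM.
  eapply (le_of_derive_ge_0 M _ r r'); [lra| |].
  - intros x Hx; apply DM, Rabs_def1; lra.
  - intros x Hx; assert (Hx' : Rabs x < 1) by (apply Rabs_def1; lra).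
    cbv beta.
    match goal with |- 0 <= ?A => cut (0 <= x * A) end.
    { intros Hxx; apply Rmult_le_reg_l with x; lra. }
    pose proof (continuous_circle_C1 Hfx x Hx') as KKx.
    pose proof (continuous_circle_C1 Hfy x Hx') as KKy.
    pose proof (continuous_circle_C1 Hf x Hx') as KKf.
    pose proof (continuous_circle_C1 HE x Hx') as KKE.
    rewrite <- turn_scal by cont.
    rewrite (turn_ext _ (fun t => 2 * (f (pt x t) * E (pt x t) * 1))).
    + rewrite turn_scal by cont. fold (N x). assert (0 <= N x) by (apply PN; lra). lra.
    + intros t; unfold E; rewrite radial_pt; ring.
Qed.
End Harmonic.

(** * Inner products *)

Section Hilbert.
Variables (H : CompleteNormedModule R_AbsRing) (ip : H -> H -> R).
Hypothesis Hip : is_inner_product H ip.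

Lemma ip_plus_l (x y z : H) : ip (plus x y) z = ip x z + ip y z.
Proof. apply (ip_plus _ _ Hip). Qed.
Lemma ip_scal_l (a : R) (x y : H) : ip (scal a x) y = a * ip x y.
Proof. apply (ip_scal _ _ Hip). Qed.
Lemma ip_plus_r (x y z : H) : ip z (plus x y) = ip z x + ip z y.
Proof. rewrite !(ip_sym _ _ Hip z); apply ip_plus_l. Qed.
Lemma ip_scal_r (a : R) (x y : H) : ip y (scal a x) = a * ip y x.
Proof. rewrite !(ip_sym _ _ Hip y); apply ip_scal_l. Qed.
Lemma ip_zero_l (y : H) : ip zero y = 0.
Proof.
  generalize (ip_plus_l zero zero y); rewrite plus_zero_l; lra.
Qed.
Lemma ip_opp_l (x y : H) : ip (opp x) y = - ip x y.
Proof.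
  assert (E : plus x (opp x) = zero) by exact (plus_opp_r (G := H) x).
  generalize (ip_plus_l x (opp x) y); rewrite E, ip_zero_l; lra.
Qed.
Lemma ip_opp_r (x y : H) : ip y (opp x) = - ip y x.
Proof. rewrite !(ip_sym _ _ Hip y); apply ip_opp_l. Qed.
Lemma ip_minus_l (x y z : H) : ip (minus x y) z = ip x z - ip y z.
Proof. unfold minus; rewrite ip_plus_l, ip_opp_l; ring. Qed.
Lemma ip_minus_r (x y z : H) : ip z (minus x y) = ip z x - ip z y.
Proof. unfold minus; rewrite ip_plus_r, ip_opp_r; ring. Qed.
Lemma ip_zero_r (y : H) : ip y zero = 0.
Proof. rewrite (ip_sym _ _ Hip); apply ip_zero_l. Qed.

Lemma ip_self (x : H) : ip x x = norm x ^ 2.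
Proof. apply (ip_norm _ _ Hip). Qed.

Lemma ip_self_eq_0 (x : H) : ip x x = 0 -> x = zero.
Proof.
  rewrite ip_self; intros E; apply (norm_eq_zero x).
  generalize (norm_ge_0 x); simpl in E; nra.
Qed.

(** Turns identities between vectors into ring identities between reals. *)
Lemma ip_ext (x y : H) : (forall h, ip x h = ip y h) -> x = y.
Proof.
  intros E; assert (Z : minus x y = zero).
  { apply ip_self_eq_0; rewrite ip_minus_l, E; ring. }
  apply (plus_reg_r (opp y)); rewrite plus_opp_r; exact Z.
Qed.

Lemma norm_sq (x : H) : norm x ^ 2 = ip x x.
Proof. now rewrite ip_self. Qed.

Lemma norm_eq_sqrt (x : H) (a : R) : 0 <= a -> ip x x = a ^ 2 -> norm x = a.
Proof.
  rewrite ip_self; intros Ha E; pose proof (norm_ge_0 x).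
  apply Rle_antisym; apply le_of_sq_le; lra.
Qed.

Lemma ip_CS (x y : H) : ip x y ^ 2 <= ip x x * ip y y.
Proof.
  destruct (Req_dec (ip y y) 0) as [E|E].
  - rewrite (ip_self_eq_0 _ E), !ip_zero_r; lra.
  - assert (P : 0 < ip y y).
    { rewrite ip_self in *; pose proof (pow2_ge_0 (norm y)); lra. }
    pose proof (pow2_ge_0 (norm (minus (scal (ip y y) x) (scal (ip x y) y)))) as Q.
    rewrite norm_sq, !ip_minus_l, !ip_minus_r, !ip_scal_l, !ip_scal_r in Q.
    rewrite (ip_sym _ _ Hip y x) in Q.
    assert (0 <= ip y y * (ip x x * ip y y - ip x y ^ 2)) by (simpl; lra).
    nra.
Qed.

Lemma ip_le (x y : H) : Rabs (ip x y) <= norm x * norm y.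
Proof.
  apply le_of_sq_le.
  - apply Rmult_le_pos; apply norm_ge_0.
  - rewrite pow2_abs, Rpow_mult_distr, !norm_sq; apply ip_CS.
Qed.

Lemma is_linear_ip (h : H) : is_linear (V := R_NormedModule) (fun x : H => ip x h).
Proof.
  constructor.
  - intros; apply ip_plus_l.
  - intros; apply ip_scal_l.
  - exists (norm h + 1); pose proof (norm_ge_0 h); split; [lra|].
    intros x; change (Rabs (ip x h) <= (norm h + 1) * norm x).
    pose proof (ip_le x h); pose proof (norm_ge_0 x); nra.
Qed.

Lemma is_derive_ip (f : R -> H) (x : R) (l h : H) :
  is_derive f x l -> is_derive (fun y => ip (f y) h) x (ip l h).
Proof.
  intros D.
  pose proof (filterdiff_comp' f (fun v => ip v h) x _ _ D
    (filterdiff_linear _ (is_linear_ip h))) as D'.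
  eapply filterdiff_ext_lin; [exact D'|].
  intros y; simpl; apply ip_scal_l.
Qed.

Lemma continuous_ip {U : UniformSpace} (f : U -> H) (h : H) (x : U) :
  continuous f x -> continuous (fun y => ip (f y) h) x.
Proof.
  intros K; apply (continuous_comp f (fun v => ip v h)); [exact K|].
  exact (linear_cont (V := R_NormedModule) _ (f x) (is_linear_ip h)).
Qed.

Lemma C1_ip (F Fx Fy : C -> H) (h : H) : C1_on_disk F Fx Fy ->
  C1 (fun z => ip (F z) h) (fun z => ip (Fx z) h) (fun z => ip (Fy z) h).
Proof.
  intros HF z Hz; destruct (HF z Hz) as (D1 & D2 & K1 & K2).
  refine (conj _ (conj _ (conj _ _))).
  - now apply (is_derive_ip (fun x => F (x, snd z))).
  - now apply (is_derive_ip (fun y => F (fst z, y))).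
  - now apply continuous_ip.
  - now apply continuous_ip.
Qed.

Lemma harmonic_ip (F : C -> H) (h : H) : harmonic_on_disk F ->
  harmonicR (fun z => ip (F z) h).
Proof.
  intros (Fx & Fy & Fxx & Fxy & Fyx & Fyy & H1 & H2 & H3 & L).
  eexists; eexists; eexists; eexists; eexists; eexists.
  split; [apply C1_ip, H1|split; [apply C1_ip, H2|split; [apply C1_ip, H3|]]].
  intros z Hz; simpl.
  change (ip (Fxx z) h + ip (Fyy z) h = 0).
  rewrite <- ip_plus_l, L by auto; apply ip_zero_l.
Qed.

Definition diff0 (A B : H) (v : C) : H := plus (scal (fst v) A) (scal (snd v) B).

Lemma filterdiff0_line (F dF : C -> H) (v : C) :
  filterdiff (U := C_R_NormedModule) F (locally (RtoC 0)) dF ->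
  is_derive (fun s : R => F (s * fst v, s * snd v)) 0 (dF v).
Proof.
  intros D.
  assert (Hl : is_linear (U := R_NormedModule) (V := C_R_NormedModule)
    (fun s : R => (s * fst v, s * snd v) : C)).
  { exact (is_linear_scal_l (V := C_R_NormedModule) v). }
  assert (E0 : (0 * fst v, 0 * snd v) = RtoC 0) by (unfold RtoC; f_equal; ring).
  assert (D0 : filterdiff (U := C_R_NormedModule) F
    (locally ((fun s : R => (s * fst v, s * snd v) : C) 0)) dF) by (simpl; now rewrite E0).
  pose proof (filterdiff_comp' (U := R_NormedModule) (V := C_R_NormedModule)
    (fun s : R => (s * fst v, s * snd v) : C) F 0 _ _
    (filterdiff_linear _ Hl) D0) as D'.
  eapply filterdiff_ext_lin; [exact D'|].
  intros s; simpl; destruct D as [Ld _].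
  transitivity (dF (scal s (v : C_R_NormedModule))); [reflexivity|].
  apply (linear_scal _ Ld).
Qed.

Lemma is_derive_H_unique (f : R -> H) (x : R) (l l' : H) :
  is_derive f x l -> is_derive f x l' -> l = l'.
Proof.
  intros D D'; apply ip_ext; intros h.
  rewrite <- (is_derive_unique _ _ _ (is_derive_ip _ _ _ h D)).
  apply is_derive_unique, is_derive_ip, D'.
Qed.

Lemma filterdiff0_unique (F dF dF' : C -> H) (v : C) :
  filterdiff (U := C_R_NormedModule) F (locally (RtoC 0)) dF ->
  filterdiff (U := C_R_NormedModule) F (locally (RtoC 0)) dF' -> dF v = dF' v.
Proof.
  intros D D'; eapply is_derive_H_unique; eapply filterdiff0_line; eassumption.
Qed.

(** Differentials need only be known on the coordinate axes, where they are
    partial derivatives. *)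
Lemma filterdiff0_diff0 (F dF : C -> H) (A B : H) (v : C) :
  filterdiff (U := C_R_NormedModule) F (locally (RtoC 0)) dF ->
  is_derive (fun x => F (x, 0)) 0 A -> is_derive (fun y => F (0, y)) 0 B ->
  dF v = diff0 A B v.
Proof.
  intros D DA DB.
  assert (EA : dF (1, 0) = A).
  { eapply is_derive_H_unique; [|exact DA].
    eapply is_derive_ext; [|exact (filterdiff0_line F dF (1, 0) D)].
    intros t; simpl; do 2 f_equal; ring. }
  assert (EB : dF (0, 1) = B).
  { eapply is_derive_H_unique; [|exact DB].
    eapply is_derive_ext; [|exact (filterdiff0_line F dF (0, 1) D)].
    intros t; simpl; do 2 f_equal; ring. }
  destruct D as [Ld _]; unfold diff0; rewrite <- EA, <- EB.
  rewrite <- !(linear_scal _ Ld), <- (linear_plus _ Ld); f_equal.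
  destruct v as [x y]; simpl.
  change ((x, y) = (x * 1 + y * 0, x * 0 + y * 1)); f_equal; ring.
Qed.

Lemma is_max_stretch0_unique (F : C -> H) (L L' : R) :
  is_max_stretch0 F L -> is_max_stretch0 F L' -> L = L'.
Proof.
  intros (dF & D & (v & Hv & Ev) & M) (dF' & D' & (v' & Hv' & Ev') & M').
  apply Rle_antisym.
  - rewrite <- Ev, (filterdiff0_unique F dF dF' v D D'); auto.
  - rewrite <- Ev', (filterdiff0_unique F dF' dF v' D' D); auto.
Qed.

(** * The duality bound *)

Lemma harmonic_circle_continuous (F : C -> H) (h : H) (r t : R) :
  harmonic_on_disk F -> Rabs r < 1 -> continuous (fun t => ip (F (pt r t)) h) t.
Proof.
  intros HF Hr.
  destruct (harmonic_ip F h HF) as (fx & fy & _ & _ & _ & _ & Hf & _).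
  apply (continuous_on_circle (fun z => ip (F z) h)); [|exact Hr].
  intros z Hz; exact (C1_continuous _ _ _ z Hf Hz).
Qed.

Lemma harmonic_moments (F : C -> H) (A B h : H) (r : R) :
  harmonic_on_disk F ->
  is_derive (fun x => F (x, 0)) 0 A -> is_derive (fun y => F (0, y)) 0 B ->
  0 < r < 1 ->
  turn (fun t => ip (F (pt r t)) h * cos t) = r * (PI * ip A h) /\
  turn (fun t => ip (F (pt r t)) h * sin t) = r * (PI * ip B h).
Proof.
  intros (Fx & Fy & Fxx & Fxy & Fyx & Fyy & H1 & H2 & H3 & L) DA DB Hr.
  assert (Z : disk (RtoC 0)) by (apply disk_iff; simpl; lra).
  destruct (H1 _ Z) as (D1 & D2 & _).
  rewrite (is_derive_H_unique _ _ _ _ DA D1), (is_derive_H_unique _ _ _ _ DB D2).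
  assert (L' : forall z, disk z -> ip (Fxx z) h + ip (Fyy z) h = 0).
  { intros z Hz; rewrite <- ip_plus_l, L by auto; apply ip_zero_l. }
  assert (E1 : turn (fun t => cos t * cos t) = PI)
    by (rewrite <- turn_cos2; apply turn_ext; intros; ring).
  assert (E2 : turn (fun t => sin t * sin t) = PI)
    by (rewrite <- turn_sin2; apply turn_ext; intros; ring).
  assert (E3 : turn (fun t => sin t * cos t) = 0)
    by (rewrite <- turn_cos_sin; apply turn_ext; intros; ring).
  pose proof (first_moment _ _ _ _ _ _ _ (C1_ip _ _ _ h H1) (C1_ip _ _ _ h H2)
    (C1_ip _ _ _ h H3) L') as M.
  split.
  - rewrite (M cos (fun t => - sin t)); auto.
    + rewrite E1, E3; ring.
    + intros; auto_derive; auto; ring.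
    + intros; auto_derive; auto; ring.
    + rewrite cos_2PI, cos_0; reflexivity.
    + rewrite sin_2PI, sin_0; reflexivity.
  - rewrite (M sin cos); auto.
    + rewrite E2, turn_cos_sin; ring.
    + intros; auto_derive; auto; ring.
    + intros; auto_derive; auto; ring.
    + rewrite sin_2PI, sin_0; reflexivity.
    + rewrite cos_2PI, cos_0; reflexivity.
Qed.

(** The ellipse with semi-axes [u1] and [tau u2], which passes through [u1] at
    [t = th]. *)
Definition ellipse (u1 u2 : H) (tau th t : R) : H :=
  plus (scal (cos (t - th)) u1) (scal (tau * sin (t - th)) u2).

(** The sum of the singular values of the differential at the origin, weighted
    by [1] and [tau], when [(u1, u2)] and the directions [th], [th + pi / 2] are
    singular vectors. *)
Definition pairing0 (A B u1 u2 : H) (tau th : R) : R :=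
  ip (diff0 A B (cos th, sin th)) u1 + tau * ip (diff0 A B (- sin th, cos th)) u2.

Lemma turn_pairing (F : C -> H) (A B u1 u2 : H) (tau th r : R) :
  harmonic_on_disk F ->
  is_derive (fun x => F (x, 0)) 0 A -> is_derive (fun y => F (0, y)) 0 B ->
  0 < r < 1 ->
  turn (fun t => ip (F (pt r t)) (ellipse u1 u2 tau th t)) =
  r * (PI * pairing0 A B u1 u2 tau th).
Proof.
  intros HF DA DB Hr.
  assert (Hr' : Rabs r < 1) by (apply Rabs_def1; lra).
  pose proof (fun h t => harmonic_circle_continuous F h r t HF Hr') as K.
  pose proof (K u1) as Ku1; pose proof (K u2) as Ku2.
  destruct (harmonic_moments F A B u1 r HF DA DB Hr) as [M1 M2].
  destruct (harmonic_moments F A B u2 r HF DA DB Hr) as [M3 M4].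
  rewrite (turn_ext _ (fun t =>
    (cos th * (ip (F (pt r t)) u1 * cos t) + sin th * (ip (F (pt r t)) u1 * sin t))
    + (tau * cos th * (ip (F (pt r t)) u2 * sin t)
       - tau * sin th * (ip (F (pt r t)) u2 * cos t)))).
  - rewrite turn_plus, turn_plus, turn_minus by cont.
    rewrite !turn_scal by cont. rewrite M1, M2, M3, M4.
    unfold pairing0, diff0; simpl fst; simpl snd; rewrite !ip_plus_l, !ip_scal_l; ring.
  - intros t; unfold ellipse; rewrite ip_plus_r, !ip_scal_r, cos_minus, sin_minus; ring.
Qed.

Lemma ellipse_norm_sq (u1 u2 : H) (tau th t : R) : orthonormal_pair ip u1 u2 ->
  ip (ellipse u1 u2 tau th t) (ellipse u1 u2 tau th t) = D_ tau (t - th) ^ 2.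
Proof.
  intros (O1 & O2 & O3); unfold ellipse.
  rewrite !ip_plus_l, !ip_plus_r, !ip_scal_l, !ip_scal_r, (ip_sym _ _ Hip u2 u1), O1, O2, O3.
  rewrite D_sq; ring.
Qed.

Lemma turn_D_shift (tau th : R) : turn (fun t => D_ tau (t - th)) = turn (D_ tau).
Proof.
  exact (turn_shift (D_ tau) (- th) (continuous_D tau) (D_periodic tau)).
Qed.

Lemma continuous_D_shift (tau th t : R) : continuous (fun t => D_ tau (t - th)) t.
Proof.
  apply (continuous_comp (fun t => t - th) (D_ tau)); [cont|apply continuous_D].
Qed.

Lemma harmonic_ellipse_continuous (F : C -> H) (u1 u2 : H) (tau th r t : R) :
  harmonic_on_disk F -> Rabs r < 1 ->
  continuous (fun t => ip (F (pt r t)) (ellipse u1 u2 tau th t)) t.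
Proof.
  intros HF Hr.
  apply (continuous_ext (fun t => cos (t - th) * ip (F (pt r t)) u1
    + tau * sin (t - th) * ip (F (pt r t)) u2)).
  - intros s; unfold ellipse; rewrite ip_plus_r, !ip_scal_r; reflexivity.
  - pose proof (fun t => harmonic_circle_continuous F u1 r t HF Hr).
    pose proof (fun t => harmonic_circle_continuous F u2 r t HF Hr). cont.
Qed.

Lemma ip_ellipse_le (x u1 u2 : H) (tau th t : R) : orthonormal_pair ip u1 u2 ->
  norm x <= 1 -> ip x (ellipse u1 u2 tau th t) <= D_ tau (t - th).
Proof.
  intros O Hx; eapply Rle_trans; [apply Rle_abs|].
  eapply Rle_trans; [apply ip_le|].
  rewrite (norm_eq_sqrt (ellipse u1 u2 tau th t) (D_ tau (t - th)));
    [|apply D_nonneg|now apply ellipse_norm_sq].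
  rewrite <- (Rmult_1_l (D_ tau (t - th))) at 2.
  apply Rmult_le_compat_r; [apply D_nonneg|exact Hx].
Qed.

(** The mean of [<F, ellipse>] on the circle of radius [r] is [r / 2] times the
    weighted sum of stretchings and at most the mean of [|ellipse| = D_tau]; let
    [r -> 1]. *)
Lemma pairing0_le (F : C -> H) (A B u1 u2 : H) (tau th : R) :
  harmonic_disk_to_ball F -> orthonormal_pair ip u1 u2 ->
  is_derive (fun x => F (x, 0)) 0 A -> is_derive (fun y => F (0, y)) 0 B ->
  pairing0 A B u1 u2 tau th <= 2 * J tau.
Proof.
  intros [HF Hb] O DA DB.
  set (S := pairing0 A B u1 u2 tau th).
  assert (Hr : forall r, 0 < r < 1 -> r * S <= 2 * J tau).
  { intros r Hr.
    assert (Hr' : Rabs r < 1) by (apply Rabs_def1; lra).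
    assert (E : turn (fun t => ip (F (pt r t)) (ellipse u1 u2 tau th t))
                <= turn (fun t => D_ tau (t - th))).
    { apply turn_le.
      - intros; now apply harmonic_ellipse_continuous.
      - apply continuous_D_shift.
      - intros t; apply ip_ellipse_le; [exact O|].
        apply Rlt_le, Hb, disk_pt, Hr'. }
    rewrite (turn_pairing F A B), turn_D_shift in E by auto; fold S in E.
    rewrite J_turn.
    apply Rmult_le_reg_l with PI; [apply PI_RGT_0|].
    replace (PI * (/ PI * turn (D_ tau))) with (turn (D_ tau)) by (field; apply PI_neq0).
    lra. }
  assert (HJ : 0 <= 2 * J tau).
  { rewrite J_turn; apply Rmult_le_pos; [apply Rlt_le, PI_inv_pos|].
    apply turn_ge_0; [apply continuous_D|intros; apply D_nonneg]. }
  destruct (Rle_dec S (2 * J tau)) as [|N]; [auto|exfalso].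
  assert (HS : 2 * J tau < S) by lra.
  pose proof (Hr ((1 + 2 * J tau / S) / 2)) as Q.
  assert (Q1 : 0 <= 2 * J tau / S < 1).
  { split; [apply Rdiv_le_0_compat; lra|]. apply (Rlt_div_l _ _ S); lra. }
  specialize (Q ltac:(lra)).
  replace ((1 + 2 * J tau / S) / 2 * S) with ((S + 2 * J tau) / 2) in Q by (field; lra).
  lra.
Qed.

(** If equality holds in the duality bound then [1 - <F, v>] has small mean on
    circles near the unit circle, where [v] is the unit vector along the ellipse, and
    [|F - v|^2 <= 2 (1 - <F, v>)]. *)
Lemma boundary_defect (F : C -> H) (A B u1 u2 h : H) (tau th r : R) :
  harmonic_disk_to_ball F -> orthonormal_pair ip u1 u2 -> 0 < tau <= 1 ->
  is_derive (fun x => F (x, 0)) 0 A -> is_derive (fun y => F (0, y)) 0 B ->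
  pairing0 A B u1 u2 tau th = 2 * J tau -> 0 < r < 1 ->
  turn (fun t => (ip (F (pt r t)) h - ip (ellipse u1 u2 tau th t) h / D_ tau (t - th)) ^ 2)
  <= 2 * ip h h / tau * turn (D_ tau) * (1 - r).
Proof.
  intros [HF Hb] O Ht DA DB HS Hr.
  assert (Hr' : Rabs r < 1) by (apply Rabs_def1; lra).
  pose proof (fun t => continuous_D_shift tau th t) as KD.
  pose proof (fun t => harmonic_circle_continuous F h r t HF Hr') as KF.
  pose proof (fun t => harmonic_ellipse_continuous F u1 u2 tau th r t HF Hr') as KE.
  assert (PD : forall t, 0 < D_ tau (t - th)) by (intros; apply D_pos; lra).
  assert (Kh : forall t, continuous (fun t => ip (ellipse u1 u2 tau th t) h / D_ tau (t - th)) t).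
  { intros t; apply continuous_Rdiv; [apply Rgt_not_eq, PD| |apply KD].
    apply (continuous_ext (fun t => cos (t - th) * ip u1 h + tau * sin (t - th) * ip u2 h)).
    - intros s; unfold ellipse; rewrite ip_plus_l, !ip_scal_l; reflexivity.
    - cont. }
  assert (E : turn (fun t => D_ tau (t - th) - ip (F (pt r t)) (ellipse u1 u2 tau th t))
    = turn (D_ tau) * (1 - r)).
  { rewrite turn_minus, turn_D_shift, (turn_pairing F A B), HS, J_turn by auto.
    field; apply PI_neq0. }
  replace (2 * ip h h / tau * turn (D_ tau) * (1 - r)) with
    (2 * ip h h / tau * (turn (D_ tau) * (1 - r))) by ring.
  rewrite <- E, <- turn_scal by cont.
  apply turn_le; [cont|cont|]. intros t.
  set (d := D_ tau (t - th)) in *; set (x := F (pt r t)); set (m := ellipse u1 u2 tau th t).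
  assert (Hd : 0 < d) by apply PD.
  assert (Hd' : tau <= d) by (apply D_ge; lra).
  assert (Hm : ip m m = d ^ 2) by (apply ellipse_norm_sq, O).
  assert (Hx : ip x x <= 1).
  { assert (Hn : norm x < 1) by (apply Hb, disk_pt, Hr').
    rewrite ip_self; pose proof (norm_ge_0 x); nra. }
  assert (Hle : ip x m <= d).
  { apply ip_ellipse_le; [exact O|]. apply Rlt_le, Hb, disk_pt, Hr'. }
  assert (Hh : 0 <= ip h h) by (rewrite ip_self; apply pow2_ge_0).
  pose proof (ip_CS (minus x (scal (/ d) m)) h) as CS.
  rewrite !ip_minus_l, !ip_minus_r, !ip_scal_l, !ip_scal_r, Hm, (ip_sym _ _ Hip m x) in CS.
  replace (/ d * ip m h) with (ip m h / d) in CS by (unfold Rdiv; ring).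
  eapply Rle_trans; [exact CS|].
  replace (2 * ip h h / tau * (d - ip x m)) with (2 / tau * (d - ip x m) * ip h h)
    by (unfold Rdiv; ring).
  apply Rmult_le_compat_r; [exact Hh|].
  apply Rle_trans with (2 * (/ d * (d - ip x m))).
  - replace (2 * (/ d * (d - ip x m))) with (2 - 2 * (/ d * ip x m)) by (field; lra).
    replace (/ d * (/ d * d ^ 2)) with 1 by (field; lra). lra.
  - unfold Rdiv; rewrite Rmult_assoc.
    apply Rmult_le_compat_l; [lra|]. apply Rmult_le_compat_r; [lra|].
    apply Rinv_le_contravar; lra.
Qed.

(** * Harmonic maps with the same boundary values *)

Lemma polar (z : C) : exists t, 0 <= t <= 2 * PI /\ z = pt (Cmod z) t.
Proof.
  pose proof (Cmod_sq z) as E; pose proof (Cmod_ge_0 z) as P.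
  set (r := Cmod z) in *; destruct z as [x y]; simpl fst in *; simpl snd in *.
  unfold pt; pose proof PI_RGT_0 as HPI.
  destruct (Req_dec r 0) as [R0|R0].
  - exists 0; split; [lra|]. rewrite R0 in *.
    assert (x = 0) by nra. assert (y = 0) by nra. f_equal; lra.
  - assert (Hr : 0 < r) by lra.
    set (c := x / r).
    assert (Ec : x = r * c) by (unfold c; field; lra).
    assert (Hc : -1 <= c <= 1).
    { assert (0 <= y ^ 2) by apply pow2_ge_0. 
      assert (Q : r ^ 2 * c ^ 2 <= r ^ 2 * 1) by (rewrite Ec in E; nra).
      apply Rmult_le_reg_l in Q; [|now apply pow_lt].
      nra. }
    pose proof (acos_bound c) as Hb.
    pose proof (sin_acos c Hc) as Hs.
    pose proof (cos_acos c Hc) as Hcos.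
    assert (Ps : 0 <= sin (acos c)) by (rewrite Hs; apply sqrt_pos).
    assert (Es : y ^ 2 = (r * sin (acos c)) ^ 2).
    { pose proof (cos2_sin2 (acos c)) as CS; rewrite Hcos in CS.
      rewrite Rpow_mult_distr; replace (sin (acos c) ^ 2) with (1 - c ^ 2) by lra.
      rewrite Ec in E; nra. }
    assert (Pr : 0 <= r * sin (acos c)) by (apply Rmult_le_pos; lra).
    destruct (Rle_dec 0 y) as [Hy|Hy].
    + exists (acos c); split; [lra|]; rewrite Hcos; f_equal; [exact Ec|nra].
    + exists (2 * PI - acos c); split; [lra|].
      rewrite cos_minus, sin_minus, cos_2PI, sin_2PI, Hcos.
      f_equal; [lra|nra].
Qed.

(** The integral of [<F - G, h>^2] over the circle of radius [r] increases with [r],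
    and the two hypotheses make it tend to [0] as [r -> 1]. *)
Lemma harmonic_eq_of_boundary (F G : C -> H) (h : H) (psi : R -> R) (c : R) :
  harmonic_on_disk F -> harmonic_on_disk G -> F (RtoC 0) = G (RtoC 0) ->
  (forall t, continuous psi t) ->
  (forall r, 0 < r < 1 -> turn (fun t => (ip (F (pt r t)) h - psi t) ^ 2) <= c * (1 - r)) ->
  (forall r, 0 < r < 1 -> turn (fun t => (ip (G (pt r t)) h - psi t) ^ 2) <= c * (1 - r)) ->
  forall z, disk z -> ip (F z) h = ip (G z) h.
Proof.
  intros HF HG E0 Kpsi BF BG z Hz.
  destruct (polar z) as [t [Ht Ez]].
  destruct (Req_dec (Cmod z) 0) as [R0|R0].
  { rewrite R0 in Ez.
    replace z with (RtoC 0) by (rewrite Ez; unfold pt, RtoC; f_equal; ring).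
    now rewrite E0. }
  assert (Hr : 0 < Cmod z < 1) by (unfold disk in Hz; generalize (Cmod_ge_0 z); lra).
  set (r := Cmod z) in *; clearbody r; subst z.
  pose proof (fun r t => harmonic_circle_continuous F h r t HF) as KF.
  pose proof (fun r t => harmonic_circle_continuous G h r t HG) as KG.
  destruct (harmonic_ip F h HF) as (fx & fy & fxx & fxy & fyx & fyy & F1 & F2 & F3 & FL).
  destruct (harmonic_ip G h HG) as (gx & gy & gxx & gxy & gyx & gyy & G1 & G2 & G3 & GL).
  assert (L : forall z, disk z ->
    fxx z + -1 * gxx z + (fyy z + -1 * gyy z) = 0).
  { intros z Hz'; specialize (FL z Hz'); specialize (GL z Hz').
    change (fxx z + fyy z = 0) in FL; change (gxx z + gyy z = 0) in GL. lra. }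
  pose proof (square_mean_increasing _ _ _ _ _ _ _
    (C1_plus _ _ _ _ _ _ F1 (C1_const_Rmult (-1) _ _ _ G1))
    (C1_plus _ _ _ _ _ _ F2 (C1_const_Rmult (-1) _ _ _ G2))
    (C1_plus _ _ _ _ _ _ F3 (C1_const_Rmult (-1) _ _ _ G3)) L) as Mono.
  cbv beta in Mono.
  set (M := fun r => turn (fun t => (ip (F (pt r t)) h + -1 * ip (G (pt r t)) h) ^ 2)).
  assert (KM : forall q, 0 < q < 1 -> forall t,
    continuous (fun t => (ip (F (pt q t)) h + -1 * ip (G (pt q t)) h) ^ 2) t).
  { intros q Hq s; assert (Hq' : Rabs q < 1) by (apply Rabs_def1; lra).
    pose proof (fun t => KF q t Hq'); pose proof (fun t => KG q t Hq'). cont. }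
  assert (Up : forall q, 0 < q < 1 -> M q <= 4 * c * (1 - q)).
  { intros q Hq; assert (Hq' : Rabs q < 1) by (apply Rabs_def1; lra).
    pose proof (fun t => KF q t Hq') as KFq; pose proof (fun t => KG q t Hq') as KGq.
    apply Rle_trans with (turn (fun t => 2 * (ip (F (pt q t)) h - psi t) ^ 2
      + 2 * (ip (G (pt q t)) h - psi t) ^ 2)).
    - apply turn_le; [apply KM, Hq|cont|].
      intros s. set (x := ip (F (pt q s)) h); set (y := ip (G (pt q s)) h).
      generalize (pow2_ge_0 (x - psi s + (y - psi s))); lra.
    - rewrite turn_plus, !turn_scal by cont.
      generalize (BF q Hq) (BG q Hq); lra. }
  assert (P : 0 <= M r) by (apply turn_ge_0; [apply KM, Hr|intros; apply pow2_ge_0]).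
  assert (M0 : M r = 0).
  { destruct (Rle_lt_or_eq_dec _ _ P) as [Hpos|]; [exfalso|auto].
    assert (Hc : 0 <= c).
    { pose proof (Up r Hr) as U; destruct (Rle_dec 0 c); [auto|].
      assert (c * (1 - r) < 0 * (1 - r)) by (apply Rmult_lt_compat_r; lra). lra. }
    set (d := Rmin ((1 - r) / 2) (M r / (8 * (c + 1)))).
    assert (Hd1 : d <= (1 - r) / 2) by apply Rmin_l.
    assert (Hd2 : d <= M r / (8 * (c + 1))) by apply Rmin_r.
    assert (Hd0 : 0 < d) by (apply Rmin_glb_lt; [lra|apply Rdiv_lt_0_compat; lra]).
    assert (M r <= M (1 - d)) by (apply Mono; lra).
    pose proof (Up (1 - d) ltac:(lra)) as U.
    replace (1 - (1 - d)) with d in U by ring.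
    assert (4 * c * d <= 4 * c * (M r / (8 * (c + 1)))) by (apply Rmult_le_compat_l; lra).
    assert (4 * c * (M r / (8 * (c + 1))) < M r).
    { replace (4 * c * (M r / (8 * (c + 1)))) with (M r * (c / (2 * (c + 1)))) by (field; lra).
      rewrite <- (Rmult_1_r (M r)) at 2. apply Rmult_lt_compat_l; [exact Hpos|].
      apply (Rlt_div_l _ _ (2 * (c + 1))); lra. }
    lra. }
  pose proof (turn_eq_0 _ (KM r Hr) (fun t => pow2_ge_0 _) M0 t Ht) as Z.
  cbv beta in Z.
  destruct (Req_dec (ip (F (pt r t)) h + -1 * ip (G (pt r t)) h) 0) as [Q|Q]; [lra|].
  exfalso; exact (pow_nonzero _ 2 Q Z).
Qed.

(** * Poisson integrals with values in a plane *)

Definition poissonV (a b : R -> R) (u1 u2 : H) (z : C) : H :=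
  plus (scal (poissonR a z) u1) (scal (poissonR b z) u2).

Lemma C1_combination (u ux uy v vx vy : C -> R) (u1 u2 : H) :
  C1 u ux uy -> C1 v vx vy ->
  C1_on_disk (fun z => plus (scal (u z) u1) (scal (v z) u2))
    (fun z => plus (scal (ux z) u1) (scal (vx z) u2))
    (fun z => plus (scal (uy z) u1) (scal (vy z) u2)).
Proof.
  intros Hu Hv z Hz.
  destruct (Hu z Hz) as (D1 & D2 & K1 & K2); destruct (Hv z Hz) as (E1 & E2 & K3 & K4).
  assert (S : forall (f : R -> R) (x l : R) (w : H), is_derive f x l ->
    is_derive (fun x => scal (f x) w) x (scal l w)).
  { intros f x l w D; apply (is_derive_scal_l (V := H) f x l w D). }
  assert (T : forall (f : C -> R) (w : H), continuous f z ->
    continuous (fun z => scal (f z) w) z).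
  { intros f w K; exact (continuous_scal_l (V := H) f w z K). }
  refine (conj _ (conj _ (conj _ _))).
  - apply (is_derive_plus (V := H)); [apply (S (fun x => u (x, snd z)))|apply (S (fun x => v (x, snd z)))]; assumption.
  - apply (is_derive_plus (V := H)); [apply (S (fun y => u (fst z, y)))|apply (S (fun y => v (fst z, y)))]; assumption.
  - apply (continuous_plus (V := H)); apply T; assumption.
  - apply (continuous_plus (V := H)); apply T; assumption.
Qed.

Lemma poissonV_harmonic (a b : R -> R) (u1 u2 : H) :
  (forall t, continuous a t) -> (forall t, continuous b t) ->
  harmonic_on_disk (poissonV a b u1 u2).
Proof.
  intros Ka Kb.
  destruct (poissonR_harmonic a Ka) as (fx & fy & fxx & fxy & fyx & fyy & F1 & F2 & F3 & FL).
  destruct (poissonR_harmonic b Kb) as (gx & gy & gxx & gxy & gyx & gyy & G1 & G2 & G3 & GL).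
  eexists; eexists; eexists; eexists; eexists; eexists.
  split; [exact (C1_combination _ _ _ _ _ _ u1 u2 F1 G1)|].
  split; [exact (C1_combination _ _ _ _ _ _ u1 u2 F2 G2)|].
  split; [exact (C1_combination _ _ _ _ _ _ u1 u2 F3 G3)|].
  intros z Hz; specialize (FL z Hz); specialize (GL z Hz).
  change (fxx z + fyy z = 0) in FL; change (gxx z + gyy z = 0) in GL.
  apply ip_ext; intros h; simpl.
  rewrite !ip_plus_l, !ip_scal_l, ip_zero_l.
  transitivity ((fxx z + fyy z) * ip u1 h + (gxx z + gyy z) * ip u2 h); [ring|].
  rewrite FL, GL; ring.
Qed.

Lemma poissonR_linear (a b : R -> R) (p q : R) (z : C) : disk z ->
  (forall t, continuous a t) -> (forall t, continuous b t) ->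
  p * poissonR a z + q * poissonR b z = poissonR (fun t => p * a t + q * b t) z.
Proof.
  intros Hz Ka Kb; unfold poissonR.
  pose proof (fun t => continuous_poisson_kernel z t Hz) as KP.
  rewrite (turn_ext (fun t => poisson_kernel z t * (p * a t + q * b t))
    (fun t => p * (poisson_kernel z t * a t) + q * (poisson_kernel z t * b t)))
    by (intros; ring).
  rewrite turn_plus, !turn_scal by cont. ring.
Qed.

Lemma poisson_kernel_ge (z : C) (t : R) : disk z ->
  (1 - Cmod z) / (1 + Cmod z) <= poisson_kernel z t.
Proof.
  intros Hz; pose proof (radial_le_Cmod z t Hz) as Hm; apply Rabs_le_between in Hm.
  unfold disk in Hz; pose proof (Cmod_ge_0 z) as P; unfold poisson_kernel.
  set (r := Cmod z) in *; set (m := fst z * cos t + snd z * sin t) in *.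
  replace ((1 - r) / (1 + r)) with ((1 - r ^ 2) / (1 + r) ^ 2) by (field; lra).
  apply Rmult_le_compat_l; [nra|].
  apply Rinv_le_contravar; nra.
Qed.

(** A zero mean keeps the Poisson integral of a function bounded by [1] away from [1]:
    the kernel is at least [k = (1 - |z|) / (1 + |z|)], so the Poisson mean of [1 - g] is at
    least [k] times its uniform mean, which is [1]. *)
Lemma poissonR_le (g : R -> R) (z : C) : disk z -> (forall t, continuous g t) ->
  (forall t, g t <= 1) -> turn g = 0 ->
  poissonR g z <= 1 - (1 - Cmod z) / (1 + Cmod z).
Proof.
  intros Hz Kg Hg Zg; unfold poissonR.
  pose proof (fun t => continuous_poisson_kernel z t Hz) as KP.
  set (k := (1 - Cmod z) / (1 + Cmod z)).
  assert (E : k * turn (fun t => 1 - g t) <=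
              turn (fun t => poisson_kernel z t * (1 - g t))).
  { rewrite <- turn_scal by cont. apply turn_le; [cont|cont|].
    intros t; apply Rmult_le_compat_r; [generalize (Hg t); lra|].
    now apply poisson_kernel_ge. }
  rewrite turn_minus, turn_const, Zg in E by cont.
  rewrite (turn_ext _ (fun t => poisson_kernel z t - poisson_kernel z t * g t)) in E
    by (intros; ring).
  rewrite turn_minus, turn_poisson_kernel in E by (auto || cont).
  pose proof two_PI_pos.
  apply Rmult_le_reg_l with (2 * PI); [lra|].
  rewrite <- Rmult_assoc, Rinv_r, Rmult_1_l by lra. lra.
Qed.

Lemma poissonV_ball (a b : R -> R) (u1 u2 : H) (z : C) :
  orthonormal_pair ip u1 u2 -> disk z ->
  (forall t, continuous a t) -> (forall t, continuous b t) ->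
  (forall t, a t ^ 2 + b t ^ 2 <= 1) -> turn a = 0 -> turn b = 0 ->
  norm (poissonV a b u1 u2 z) < 1.
Proof.
  intros (O1 & O2 & O3) Hz Ka Kb Hab Za Zb.
  set (N := norm (poissonV a b u1 u2 z)).
  assert (E : N ^ 2 = poissonR a z ^ 2 + poissonR b z ^ 2).
  { unfold N, poissonV; rewrite norm_sq.
    rewrite !ip_plus_l, !ip_plus_r, !ip_scal_l, !ip_scal_r, (ip_sym _ _ Hip u2 u1), O1, O2, O3.
    ring. }
  assert (HN : 0 <= N) by apply norm_ge_0.
  destruct (Req_dec N 0) as [->|N0]; [lra|].
  set (p := poissonR a z / N); set (q := poissonR b z / N).
  assert (Epq : p ^ 2 + q ^ 2 = 1).
  { unfold p, q; replace ((poissonR a z / N) ^ 2 + (poissonR b z / N) ^ 2) with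
      ((poissonR a z ^ 2 + poissonR b z ^ 2) / N ^ 2) by (field; lra).
    rewrite <- E; field; lra. }
  assert (EN : N = p * poissonR a z + q * poissonR b z).
  { unfold p, q; replace (poissonR a z / N * poissonR a z + poissonR b z / N * poissonR b z) with
      ((poissonR a z ^ 2 + poissonR b z ^ 2) / N) by (field; lra).
    rewrite <- E; field; lra. }
  rewrite EN, poissonR_linear by auto.
  eapply Rle_lt_trans; [apply poissonR_le; auto|].
  - cont.
  - intros t; apply le_of_sq_le; [lra|].
    assert (0 <= (p * b t - q * a t) ^ 2) by apply pow2_ge_0.
    specialize (Hab t).
    assert ((p * a t + q * b t) ^ 2 + (p * b t - q * a t) ^ 2 = (p ^ 2 + q ^ 2) * (a t ^ 2 + b t ^ 2)) by ring.
    rewrite Epq in *. lra.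
  - rewrite turn_plus, !turn_scal, Za, Zb by cont. ring.
  - unfold disk in Hz; pose proof (Cmod_ge_0 z).
    assert (0 < (1 - Cmod z) / (1 + Cmod z)) by (apply Rdiv_lt_0_compat; lra). lra.
Qed.

Lemma poissonR_0 (g : R -> R) : poissonR g (RtoC 0) = / (2 * PI) * turn g.
Proof.
  unfold poissonR; f_equal; apply turn_ext; intros t.
  unfold poisson_kernel; rewrite Cmod_0; simpl fst; simpl snd; field.
Qed.

Lemma poissonR_filterdiff0 (g : R -> R) : (forall t, continuous g t) ->
  filterdiff (U := C_R_NormedModule) (V := R_NormedModule) (poissonR g) (locally (RtoC 0))
    (fun v => fst v * (/ PI * turn (fun t => g t * cos t))
            + snd v * (/ PI * turn (fun t => g t * sin t))).
Proof.
  intros Kg; pose proof (poissonR_C1 g Kg) as HC.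
  assert (Z : disk (0, 0)) by (apply disk_iff; simpl; lra).
  pose proof (C1_differentiable _ _ _ 0 0 HC Z) as D.
  cbv beta in D.
  assert (R1 : forall t, re1 (0, 0) t = 1)
    by (intros; unfold re1, cauchy_den; simpl; field).
  assert (I1 : forall t, im1 (0, 0) t = 0)
    by (intros; unfold im1, cauchy_den; simpl; field).
  rewrite (turn_ext (fun t => 2 * re2 (0, 0) t * g t) (fun t => 2 * (g t * cos t))) in D
    by (intros; unfold re2; rewrite R1, I1; ring).
  rewrite (turn_ext (fun t => -2 * im2 (0, 0) t * g t) (fun t => 2 * (g t * sin t))) in D
    by (intros; unfold im2; rewrite R1, I1; ring).
  rewrite !turn_scal in D by cont.
  apply filterdiff_differentiable_pt_lim in D.
  apply (filterdiff_ext (U := C_R_NormedModule)) with (f := fun u : R * R => poissonR g (fst u, snd u));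
    [intros []; reflexivity|].
  eapply filterdiff_ext_lin; [exact D|].
  intros [x y]; simpl; field; apply PI_neq0.
Qed.

Lemma poissonV_filterdiff0 (a b : R -> R) (u1 u2 : H) :
  (forall t, continuous a t) -> (forall t, continuous b t) ->
  filterdiff (U := C_R_NormedModule) (poissonV a b u1 u2) (locally (RtoC 0))
    (diff0 (plus (scal (/ PI * turn (fun t => a t * cos t)) u1)
                 (scal (/ PI * turn (fun t => b t * cos t)) u2))
           (plus (scal (/ PI * turn (fun t => a t * sin t)) u1)
                 (scal (/ PI * turn (fun t => b t * sin t)) u2))).
Proof.
  intros Ka Kb.
  pose proof (filterdiff_comp' (U := C_R_NormedModule) (V := R_NormedModule) (W := H)
    (poissonR a) (fun k => scal k u1) _ _ _ (poissonR_filterdiff0 a Ka)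
    (filterdiff_linear _ (is_linear_scal_l (V := H) u1))) as D1.
  pose proof (filterdiff_comp' (U := C_R_NormedModule) (V := R_NormedModule) (W := H)
    (poissonR b) (fun k => scal k u2) _ _ _ (poissonR_filterdiff0 b Kb)
    (filterdiff_linear _ (is_linear_scal_l (V := H) u2))) as D2.
  pose proof (filterdiff_plus_fct _ _ _ _ D1 D2) as D.
  eapply filterdiff_ext_lin; [exact D|].
  intros v; apply ip_ext; intros h; unfold diff0.
  rewrite !ip_plus_l, !ip_scal_l, !ip_plus_l, !ip_scal_l; ring.
Qed.

(** * The extremal maps *)

Definition cos_part (tau th t : R) : R := cos (t - th) / D_ tau (t - th).
Definition sin_part (tau th t : R) : R := tau * sin (t - th) / D_ tau (t - th).

Lemma continuous_parts (tau th : R) : 0 < tau ->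
  (forall t, continuous (cos_part tau th) t) /\ (forall t, continuous (sin_part tau th) t).
Proof.
  intros Ht; split; intros t; unfold cos_part, sin_part;
  (apply continuous_Rdiv; [apply Rgt_not_eq, D_pos, Ht|cont|apply continuous_D_shift]).
Qed.

Lemma parts_sq (tau th t : R) : 0 < tau -> cos_part tau th t ^ 2 + sin_part tau th t ^ 2 = 1.
Proof.
  intros Ht; unfold cos_part, sin_part; pose proof (D_pos tau (t - th) Ht) as P.
  pose proof (D_sq tau (t - th)) as E.
  transitivity ((cos (t - th) ^ 2 + tau ^ 2 * sin (t - th) ^ 2) / D_ tau (t - th) ^ 2);
    [field; lra|].
  rewrite <- E; field; lra.
Qed.

Lemma turn_parts (tau th : R) : 0 < tau ->
  turn (cos_part tau th) = 0 /\ turn (sin_part tau th) = 0.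
Proof.
  intros Ht; destruct (continuous_parts tau th Ht) as [Kc Ks].
  split; apply turn_antiperiodic; auto; intros t; unfold cos_part, sin_part;
  replace (t + PI - th) with (t - th + PI) by ring;
  rewrite D_PI, ?neg_cos, ?neg_sin; unfold Rdiv; ring.
Qed.

(** Reduces vector-valued Poisson integrals to real ones. *)
Lemma is_RInt_scal_vector (f : R -> R) (a b I : R) (u : H) :
  is_RInt f a b I -> is_RInt (fun t => scal (f t) u) a b (scal I u).
Proof.
  intros HI; unfold is_RInt in *.
  assert (RS : forall ptd, Riemann_sum (fun t => scal (f t) u) ptd = scal (Riemann_sum f ptd) u).
  { apply (SF_cons_ind (fun ptd => Riemann_sum (fun t => scal (f t) u) ptd = scal (Riemann_sum f ptd) u)).
    - intros x0; unfold Riemann_sum; simpl; symmetry; apply (scal_zero_l (V := H)).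
    - intros h s IH; rewrite !Riemann_sum_cons, IH.
      etransitivity; [|symmetry; apply (scal_distr_r (V := H))].
      f_equal; apply (scal_assoc (V := H)). }
  apply (filterlim_ext (fun ptd => scal (scal (sign (b - a)) (Riemann_sum f ptd) : R) u)).
  - intros ptd; rewrite RS; symmetry; apply (scal_assoc (V := H)).
  - refine (filterlim_comp _ _ _ _ (fun k => scal k u) _ _ _ HI _).
    exact (linear_cont (U := R_NormedModule) (V := H) _ I (is_linear_scal_l u)).
Qed.

Lemma poisson_plane (a b : R -> R) (u1 u2 : H) (f : R -> H) (z : C) : disk z ->
  (forall t, continuous a t) -> (forall t, continuous b t) ->
  (forall t, f t = plus (scal (a t) u1) (scal (b t) u2)) ->
  poisson f z = poissonV a b u1 u2 z.
Proof.
  intros Hz Ka Kb Hf; unfold poisson, circle_mean, poissonV, poissonR.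
  pose proof (fun t => continuous_poisson_kernel z t Hz) as KP.
  assert (I : forall g, (forall t, continuous g t) ->
    is_RInt (fun t => poisson_kernel z t * g t) 0 (2 * PI)
      (turn (fun t => poisson_kernel z t * g t))).
  { intros g Kg; apply (RInt_correct (V := R_CompleteNormedModule)), ex_RInt_cont; cont. }
  pose proof (is_RInt_plus _ _ _ _ _ _ (is_RInt_scal_vector _ _ _ _ u1 (I a Ka))
    (is_RInt_scal_vector _ _ _ _ u2 (I b Kb))) as S.
  assert (E : RInt (fun t => scal (poisson_kernel z t) (f t)) 0 (2 * PI) =
    plus (scal (turn (fun t => poisson_kernel z t * a t)) u1)
         (scal (turn (fun t => poisson_kernel z t * b t)) u2)).
  { refine (eq_trans _ (is_RInt_unique _ _ _ _ S)); apply RInt_ext; intros t _; rewrite Hf.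
    apply ip_ext; intros h; rewrite !ip_plus_l, !ip_scal_l, ip_plus_l, !ip_scal_l; ring. }
  rewrite E; apply ip_ext; intros h; rewrite !ip_plus_l, !ip_scal_l, ip_plus_l, !ip_scal_l; ring.
Qed.

Lemma Fext_poissonV (u1 u2 : H) (tau : R) (z : C) : 0 < tau -> disk z ->
  Fext u1 u2 tau z = poissonV (cos_part tau 0) (sin_part tau 0) u1 u2 z.
Proof.
  intros Ht Hz; destruct (continuous_parts tau 0 Ht) as [Kc Ks].
  apply poisson_plane; auto.
  intros t; unfold Phi, cos_part, sin_part; rewrite Rminus_0_r.
  apply ip_ext; intros h; rewrite !ip_scal_l, !ip_plus_l, !ip_scal_l; unfold Rdiv; ring.
Qed.

Definition rot (th : R) (z : C) : C :=
  (cos th * fst z + sin th * snd z, - sin th * fst z + cos th * snd z).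

Lemma Cmod_rot (th : R) (z : C) : Cmod (rot th z) = Cmod z.
Proof.
  unfold Cmod; f_equal; simpl fst; simpl snd.
  replace (fst z ^ 2 + snd z ^ 2) with ((cos th ^ 2 + sin th ^ 2) * (fst z ^ 2 + snd z ^ 2))
    by (rewrite cos2_sin2; ring).
  ring.
Qed.

(** Rotating the point amounts to rotating the density, since the kernel depends
    only on [|z|] and on the angle between [z] and [exp (i t)]. *)
Lemma poissonR_rot (g : R -> R) (th : R) (z : C) : disk z ->
  (forall t, continuous g t) -> (forall t, g (t + 2 * PI) = g t) ->
  poissonR g (rot th z) = poissonR (fun t => g (t - th)) z.
Proof.
  intros Hz Kg Pg; unfold poissonR; f_equal.
  pose proof (fun t => continuous_poisson_kernel z t Hz) as KP.
  assert (Kth : forall t, continuous (fun t => g (t - th)) t).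
  { intros t; apply (continuous_comp (fun t => t - th) g); [cont|apply Kg]. }
  rewrite <- (turn_shift (fun t => poisson_kernel z t * g (t - th)) th).
  - apply turn_ext; intros t; replace (t + th - th) with t by ring; f_equal.
    unfold poisson_kernel; rewrite Cmod_rot; do 4 f_equal.
    unfold rot; simpl fst; simpl snd; rewrite cos_plus, sin_plus; ring.
  - cont.
  - intros t; replace (t + 2 * PI - th) with (t - th + 2 * PI) by ring; rewrite Pg; f_equal.
    unfold poisson_kernel; now rewrite cos_plus_2PI, sin_plus_2PI.
Qed.

Lemma poissonV_rot (u1 u2 : H) (tau th : R) (z : C) : 0 < tau -> disk z ->
  poissonV (cos_part tau th) (sin_part tau th) u1 u2 z = Fext u1 u2 tau (rot th z).
Proof.
  intros Ht Hz; destruct (continuous_parts tau 0 Ht) as [Kc Ks].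
  rewrite Fext_poissonV by (auto; unfold disk; rewrite Cmod_rot; exact Hz).
  unfold poissonV; rewrite !poissonR_rot; auto.
  - assert (E1 : forall t, cos_part tau 0 (t - th) = cos_part tau th t)
      by (intros; unfold cos_part; now rewrite Rminus_0_r).
    assert (E2 : forall t, sin_part tau 0 (t - th) = sin_part tau th t)
      by (intros; unfold sin_part; now rewrite Rminus_0_r).
    do 2 f_equal; unfold poissonR; f_equal; apply turn_ext; intros t; now rewrite ?E1, ?E2.
  - intros t; unfold sin_part; rewrite !Rminus_0_r, D_periodic, sin_plus_2PI; reflexivity.
  - intros t; unfold cos_part; rewrite !Rminus_0_r, D_periodic, cos_plus_2PI; reflexivity.
Qed.

Lemma poissonV_disk_to_ball (u1 u2 : H) (tau th : R) : orthonormal_pair ip u1 u2 ->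
  0 < tau -> harmonic_disk_to_ball (poissonV (cos_part tau th) (sin_part tau th) u1 u2).
Proof.
  intros O Ht; destruct (continuous_parts tau th Ht) as [Kc Ks].
  destruct (turn_parts tau th Ht) as [Zc Zs].
  split; [now apply poissonV_harmonic|].
  intros z Hz; apply poissonV_ball; auto.
  intros t; rewrite parts_sq by exact Ht; lra.
Qed.

Lemma harmonic_on_disk_ext (F G : C -> H) : (forall z, disk z -> F z = G z) ->
  harmonic_on_disk F -> harmonic_on_disk G.
Proof.
  intros E (Fx & Fy & Fxx & Fxy & Fyx & Fyy & H1 & H2 & H3 & L).
  exists Fx, Fy, Fxx, Fxy, Fyx, Fyy; split; [|auto].
  now apply (C1_on_disk_ext F G Fx Fy).
Qed.

Lemma filterdiff0_ext (F G dF : C -> H) : (forall z, disk z -> F z = G z) ->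
  filterdiff (U := C_R_NormedModule) F (locally (RtoC 0)) dF ->
  filterdiff (U := C_R_NormedModule) G (locally (RtoC 0)) dF.
Proof.
  intros E; apply (filterdiff_ext_locally (U := C_R_NormedModule) (V := H) F G (RtoC 0) dF).
  assert (Z : disk (RtoC 0)) by (apply disk_iff; simpl; lra).
  eapply filter_imp; [|exact (locally_disk _ Z)]; auto.
Qed.

Lemma poissonV_0 (a b : R -> R) (u1 u2 : H) : turn a = 0 -> turn b = 0 ->
  poissonV a b u1 u2 (RtoC 0) = zero.
Proof.
  intros Za Zb; unfold poissonV; rewrite !poissonR_0, Za, Zb.
  apply ip_ext; intros h; rewrite ip_plus_l, !ip_scal_l, ip_zero_l; ring.
Qed.

Lemma filterdiff0_axes (F : C -> H) (A B : H) :
  filterdiff (U := C_R_NormedModule) F (locally (RtoC 0)) (diff0 A B) ->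
  is_derive (fun x => F (x, 0)) 0 A /\ is_derive (fun y => F (0, y)) 0 B.
Proof.
  intros D; split.
  - replace A with (diff0 A B (1, 0)).
    + eapply is_derive_ext; [|exact (filterdiff0_line F _ (1, 0) D)].
      intros t; simpl; do 2 f_equal; ring.
    + apply ip_ext; intros h; unfold diff0; rewrite ip_plus_l, !ip_scal_l; simpl; ring.
  - replace B with (diff0 A B (0, 1)).
    + eapply is_derive_ext; [|exact (filterdiff0_line F _ (0, 1) D)].
      intros t; simpl; do 2 f_equal; ring.
    + apply ip_ext; intros h; unfold diff0; rewrite ip_plus_l, !ip_scal_l; simpl; ring.
Qed.

(** The mixed first moments of the boundary values vanish by the symmetry
    [t -> - t]. *)
Lemma Fext_filterdiff0 (u1 u2 : H) (tau : R) : 0 < tau ->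
  filterdiff (U := C_R_NormedModule) (Fext u1 u2 tau) (locally (RtoC 0))
    (diff0 (scal (alpha tau) u1) (scal (beta tau) u2)).
Proof.
  intros Ht; destruct (continuous_parts tau 0 Ht) as [Kc Ks].
  eapply filterdiff0_ext; [intros z Hz; symmetry; now apply Fext_poissonV|].
  eapply filterdiff_ext_lin; [apply poissonV_filterdiff0; auto|].
  assert (E1 : turn (fun t => cos_part tau 0 t * cos t) = turn (fun t => cos t ^ 2 / D_ tau t)).
  { apply turn_ext; intros t; unfold cos_part; rewrite Rminus_0_r; unfold Rdiv; ring. }
  assert (E2 : turn (fun t => sin_part tau 0 t * sin t) = turn (fun t => tau * sin t ^ 2 / D_ tau t)).
  { apply turn_ext; intros t; unfold sin_part; rewrite Rminus_0_r; unfold Rdiv; ring. }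
  assert (Z : turn (fun t => cos t * sin t / D_ tau t) = 0).
  { pose proof (turn_refl (fun t => cos t * sin t / D_ tau t) ltac:(cont)) as E.
    rewrite (turn_ext _ (fun t => -1 * (cos t * sin t / D_ tau t))) in E.
    - rewrite turn_scal in E by cont. lra.
    - intros t; unfold D_.
      rewrite cos_minus, sin_minus, cos_2PI, sin_2PI.
      replace (1 * cos t + 0 * sin t) with (cos t) by ring.
      replace (0 * cos t - 1 * sin t) with (- sin t) by ring.
      replace ((- sin t) ^ 2) with (sin t ^ 2) by ring. unfold Rdiv; ring. }
  assert (E3 : turn (fun t => cos_part tau 0 t * sin t) = 0).
  { refine (eq_trans _ Z); apply turn_ext; intros t.
    unfold cos_part; rewrite Rminus_0_r; unfold Rdiv; ring. }
  assert (E4 : turn (fun t => sin_part tau 0 t * cos t) = 0).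
  { rewrite (turn_ext _ (fun t => tau * (cos t * sin t / D_ tau t))).
    - rewrite turn_scal, Z by cont; ring.
    - intros t; unfold sin_part; rewrite Rminus_0_r; unfold Rdiv; ring. }
  rewrite E1, E2, E3, E4.
  intros v; apply ip_ext; intros h; unfold diff0.
  rewrite !ip_plus_l, !ip_scal_l, !ip_plus_l, !ip_scal_l.
  unfold alpha, beta, turn; ring.
Qed.

Lemma diff0_orthogonal_sq (u1 u2 : H) (p q : R) (v : C) : orthonormal_pair ip u1 u2 ->
  norm (diff0 (scal p u1) (scal q u2) v) ^ 2 = (p * fst v) ^ 2 + (q * snd v) ^ 2.
Proof.
  intros (O1 & O2 & O3); rewrite norm_sq; unfold diff0.
  rewrite !ip_plus_l, !ip_plus_r, !ip_scal_l, !ip_scal_r, (ip_sym _ _ Hip u2 u1), O1, O2, O3.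
  ring.
Qed.

Lemma Cmod_1_sq (v : C) : Cmod v = 1 -> fst v ^ 2 + snd v ^ 2 = 1.
Proof. intros E; rewrite <- Cmod_sq, E; ring. Qed.

Lemma Fext_max_stretch (u1 u2 : H) (tau : R) : orthonormal_pair ip u1 u2 ->
  0 < tau <= 1 -> is_max_stretch0 (Fext u1 u2 tau) (alpha tau).
Proof.
  intros O Ht; eexists; split; [now apply Fext_filterdiff0|].
  pose proof (alpha_ge_1 tau Ht); pose proof (beta_ge tau Ht); pose proof (beta_le_alpha tau Ht).
  split.
  - exists (1, 0); split; [apply Cmod_1|].
    pose proof (diff0_orthogonal_sq u1 u2 (alpha tau) (beta tau) (1, 0) O) as E.
    simpl fst in E; simpl snd in E.
    pose proof (norm_ge_0 (diff0 (scal (alpha tau) u1) (scal (beta tau) u2) (1, 0))).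
    apply Rle_antisym; apply le_of_sq_le; lra.
  - intros v Hv; apply le_of_sq_le; [lra|]; rewrite diff0_orthogonal_sq by exact O.
    apply Cmod_1_sq in Hv.
    pose proof (pow2_ge_0 (snd v)).
    assert (beta tau ^ 2 <= alpha tau ^ 2) by (apply pow_incr; lra).
    assert (beta tau ^ 2 * snd v ^ 2 <= alpha tau ^ 2 * snd v ^ 2) by (apply Rmult_le_compat_r; lra).
    rewrite !Rpow_mult_distr. replace (fst v ^ 2) with (1 - snd v ^ 2) by lra. lra.
Qed.

Lemma Fext_min_stretch (u1 u2 : H) (tau : R) : orthonormal_pair ip u1 u2 ->
  0 < tau <= 1 -> is_min_stretch0 (Fext u1 u2 tau) (beta tau).
Proof.
  intros O Ht; eexists; split; [now apply Fext_filterdiff0|].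
  pose proof (alpha_ge_1 tau Ht); pose proof (beta_ge tau Ht); pose proof (beta_le_alpha tau Ht).
  split.
  - exists (0, 1); split.
    + unfold Cmod; simpl fst; simpl snd. replace (0 ^ 2 + 1 ^ 2) with 1 by ring; apply sqrt_1.
    + pose proof (diff0_orthogonal_sq u1 u2 (alpha tau) (beta tau) (0, 1) O) as E.
      simpl fst in E; simpl snd in E.
      pose proof (norm_ge_0 (diff0 (scal (alpha tau) u1) (scal (beta tau) u2) (0, 1))).
      apply Rle_antisym; apply le_of_sq_le; lra.
  - intros v Hv; apply le_of_sq_le; [apply norm_ge_0|]; rewrite diff0_orthogonal_sq by exact O.
    apply Cmod_1_sq in Hv.
    pose proof (pow2_ge_0 (fst v)).
    assert (beta tau ^ 2 <= alpha tau ^ 2) by (apply pow_incr; lra).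
    assert (beta tau ^ 2 * fst v ^ 2 <= alpha tau ^ 2 * fst v ^ 2) by (apply Rmult_le_compat_r; lra).
    rewrite !Rpow_mult_distr. replace (snd v ^ 2) with (1 - fst v ^ 2) by lra. lra.
Qed.

Lemma Fext_disk_to_ball (u1 u2 : H) (tau : R) : orthonormal_pair ip u1 u2 -> 0 < tau ->
  harmonic_disk_to_ball (Fext u1 u2 tau).
Proof.
  intros O Ht; destruct (poissonV_disk_to_ball u1 u2 tau 0 O Ht) as [Hh Hb].
  split.
  - eapply harmonic_on_disk_ext; [|exact Hh].
    intros z Hz; symmetry; now apply Fext_poissonV.
  - intros z Hz; rewrite Fext_poissonV by auto; now apply Hb.
Qed.

Lemma Fext_0 (u1 u2 : H) (tau : R) : 0 < tau -> Fext u1 u2 tau (RtoC 0) = zero.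
Proof.
  intros Ht; assert (Z : disk (RtoC 0)) by (apply disk_iff; simpl; lra).
  destruct (turn_parts tau 0 Ht) as [Zc Zs].
  rewrite Fext_poissonV by auto; now apply poissonV_0.
Qed.

Lemma Fext_admissible (u1 u2 : H) (K tau : R) : orthonormal_pair ip u1 u2 ->
  0 < tau <= 1 -> alpha tau <= K * beta tau -> admissible K (Fext u1 u2 tau).
Proof.
  intros O Ht HK; split; [apply Fext_disk_to_ball; [exact O|lra]|].
  split; [apply Fext_0; lra|].
  exists (alpha tau), (beta tau).
  split; [now apply Fext_max_stretch|split; [now apply Fext_min_stretch|]].
  pose proof (beta_ge tau Ht); pose proof (beta_le_alpha tau Ht). lra.
Qed.

(** * Rigidity *)

(** The Poisson integral of the unit field along an ellipse is an equality case of
    [pairing0_le]. *)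
Lemma poissonV_pairing0 (u1 u2 : H) (tau th : R) : orthonormal_pair ip u1 u2 -> 0 < tau ->
  exists A B, is_derive (fun x => poissonV (cos_part tau th) (sin_part tau th) u1 u2 (x, 0)) 0 A /\
    is_derive (fun y => poissonV (cos_part tau th) (sin_part tau th) u1 u2 (0, y)) 0 B /\
    pairing0 A B u1 u2 tau th = 2 * J tau.
Proof.
  intros (O1 & O2 & O3) Ht; destruct (continuous_parts tau th Ht) as [Kc Ks].
  destruct (filterdiff0_axes _ _ _ (poissonV_filterdiff0 _ _ u1 u2 Kc Ks)) as [DA DB].
  eexists; eexists; split; [exact DA|split; [exact DB|]].
  unfold pairing0, diff0; simpl fst; simpl snd.
  rewrite !ip_plus_l, !ip_scal_l, !ip_plus_l, !ip_scal_l, (ip_sym _ _ Hip u2 u1), O1, O2, O3.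
  set (a := cos_part tau th) in *; set (b := sin_part tau th) in *.
  rewrite J_turn, <- (turn_D_shift tau th).
  rewrite (turn_ext (fun t => D_ tau (t - th)) (fun t =>
    (cos th * (a t * cos t) + sin th * (a t * sin t))
    + (tau * cos th * (b t * sin t) - tau * sin th * (b t * cos t)))).
  - rewrite turn_plus, turn_plus, turn_minus by cont.
    rewrite !turn_scal by cont. ring.
  - intros t; pose proof (D_pos tau (t - th) Ht) as P.
    transitivity (a t * cos (t - th) + tau * (b t * sin (t - th))).
    + unfold a, b, cos_part, sin_part.
      transitivity ((cos (t - th) ^ 2 + tau ^ 2 * sin (t - th) ^ 2) / D_ tau (t - th)).
      * rewrite <- D_sq; field; lra.
      * field; lra.
    + rewrite cos_minus, sin_minus; ring.
Qed.

(** [F] and the Poisson integral of the unit field along the ellipse have the same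
    boundary values in mean square. *)
Lemma harmonic_rigidity (F : C -> H) (A B u1 u2 : H) (tau th : R) :
  harmonic_disk_to_ball F -> F (RtoC 0) = zero -> orthonormal_pair ip u1 u2 ->
  0 < tau <= 1 ->
  is_derive (fun x => F (x, 0)) 0 A -> is_derive (fun y => F (0, y)) 0 B ->
  pairing0 A B u1 u2 tau th = 2 * J tau ->
  forall z, disk z -> F z = Fext u1 u2 tau (rot th z).
Proof.
  intros HF F0 O Ht DA DB HS z Hz.
  assert (Ht0 : 0 < tau) by lra.
  rewrite <- poissonV_rot by auto.
  destruct (poissonV_pairing0 u1 u2 tau th O Ht0) as (A' & B' & DA' & DB' & HS').
  pose proof (poissonV_disk_to_ball u1 u2 tau th O Ht0) as HG.
  apply ip_ext; intros h.
  apply (harmonic_eq_of_boundary F (poissonV (cos_part tau th) (sin_part tau th) u1 u2) h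
    (fun t => ip (ellipse u1 u2 tau th t) h / D_ tau (t - th))
    (2 * ip h h / tau * turn (D_ tau))); auto.
  - apply HF.
  - apply HG.
  - destruct (turn_parts tau th Ht0); now rewrite F0, poissonV_0.
  - intros t; apply continuous_Rdiv; [apply Rgt_not_eq, D_pos, Ht0| |apply continuous_D_shift].
    apply (continuous_ext (fun t => cos (t - th) * ip u1 h + tau * sin (t - th) * ip u2 h)).
    + intros s; unfold ellipse; rewrite ip_plus_l, !ip_scal_l; reflexivity.
    + cont.
  - intros r Hr; now apply (boundary_defect F A B).
  - intros r Hr; now apply (boundary_defect _ A' B').
Qed.

(** Since [|dF|] on the unit circle is maximal at [v], the images of [v] and of the
    orthogonal direction are orthogonal. *)
Lemma singular_vectors (A B : H) (L l : R) (v : C) :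
  Cmod v = 1 -> norm (diff0 A B v) = L ->
  (forall w, Cmod w = 1 -> norm (diff0 A B w) <= L) ->
  0 < l -> (forall w, Cmod w = 1 -> l <= norm (diff0 A B w)) ->
  exists (u1 u2 : H) (th m : R), orthonormal_pair ip u1 u2 /\ l <= m /\
    diff0 A B (cos th, sin th) = scal L u1 /\ diff0 A B (- sin th, cos th) = scal m u2.
Proof.
  intros Hv HL Hmax Hl Hmin.
  destruct (polar v) as [th [_ Ev]]; rewrite Hv in Ev.
  assert (Ev' : v = (cos th, sin th)) by (rewrite Ev; unfold pt; f_equal; ring).
  assert (Hw : Cmod (- sin th, cos th) = 1).
  { unfold Cmod; simpl fst; simpl snd.
    replace ((- sin th) ^ 2 + cos th ^ 2) with 1 by (generalize (cos2_sin2 th); lra).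
    apply sqrt_1. }
  clear Ev; subst v.
  set (X := diff0 A B (cos th, sin th)) in *.
  set (Y := diff0 A B (- sin th, cos th)) in *.
  set (m := norm Y).
  assert (Hm : l <= m) by (apply Hmin, Hw).
  assert (HlL : l <= L) by (rewrite <- HL; apply Hmin, Hv).
  assert (EX : ip X X = L ^ 2) by (rewrite ip_self, HL; reflexivity).
  assert (EY : ip Y Y = m ^ 2) by apply ip_self.
  assert (Hcomb : forall p q, p ^ 2 + q ^ 2 = 1 ->
    p ^ 2 * ip X X + 2 * p * q * ip X Y + q ^ 2 * ip Y Y <= L ^ 2).
  { intros p q Hpq.
    set (w := (p * cos th - q * sin th, p * sin th + q * cos th) : C).
    assert (Cw : Cmod w = 1).
    { unfold Cmod; simpl fst; simpl snd.
      replace ((p * cos th - q * sin th) ^ 2 + (p * sin th + q * cos th) ^ 2)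
        with ((p ^ 2 + q ^ 2) * (cos th ^ 2 + sin th ^ 2)) by ring.
      rewrite Hpq, cos2_sin2, Rmult_1_l; apply sqrt_1. }
    pose proof (Hmax w Cw) as Hb.
    assert (E : diff0 A B w = plus (scal p X) (scal q Y)).
    { apply ip_ext; intros h; unfold X, Y, diff0, w; simpl fst; simpl snd.
      rewrite !ip_plus_l, !ip_scal_l, !ip_plus_l, !ip_scal_l; ring. }
    rewrite E in Hb.
    assert (Hb2 : norm (plus (scal p X) (scal q Y)) ^ 2 <= L ^ 2)
      by (apply pow_incr; split; [apply norm_ge_0|exact Hb]).
    rewrite norm_sq, !ip_plus_l, !ip_plus_r, !ip_scal_l, !ip_scal_r, (ip_sym _ _ Hip Y X) in Hb2.
    lra. }
  assert (O : ip X Y = 0).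
  { set (g := ip X Y) in *.
    (* the first-order condition at the maximum, tested at slope g / L^2 *)
    set (e := g / L ^ 2); set (k := sqrt (1 + e ^ 2)).
    assert (L2 : 0 < L ^ 2) by (apply pow_lt; lra).
    assert (Hk2 : k ^ 2 = 1 + e ^ 2) by (apply pow2_sqrt; generalize (pow2_ge_0 e); lra).
    assert (Hk : 0 < k) by (apply sqrt_lt_R0; generalize (pow2_ge_0 e); lra).
    assert (Hpq : (1 / k) ^ 2 + (e / k) ^ 2 = 1).
    { replace ((1 / k) ^ 2 + (e / k) ^ 2) with ((1 + e ^ 2) / k ^ 2) by (field; lra).
      rewrite <- Hk2; field; lra. }
    pose proof (Hcomb (1 / k) (e / k) Hpq) as Q.
    rewrite EX, EY in Q.
    assert (Q2 : L ^ 2 + 2 * e * g + e ^ 2 * m ^ 2 <= L ^ 2 * (1 + e ^ 2)).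
    { rewrite <- Hk2.
      replace (L ^ 2 + 2 * e * g + e ^ 2 * m ^ 2) with
        (((1 / k) ^ 2 * L ^ 2 + 2 * (1 / k) * (e / k) * g + (e / k) ^ 2 * m ^ 2) * k ^ 2)
        by (field; lra).
      apply Rmult_le_compat_r; [apply pow2_ge_0|exact Q]. }
    assert (Eg : g = e * L ^ 2) by (unfold e; field; lra).
    assert (0 <= e ^ 2 * m ^ 2) by (rewrite <- Rpow_mult_distr; apply pow2_ge_0).
    assert (Z : e ^ 2 * L ^ 2 <= 0) by (rewrite Eg in Q2; lra).
    assert (Ze : e = 0).
    { destruct (Req_dec e 0) as [|N]; [auto|].
      assert (0 < e ^ 2) by (apply pow2_gt_0; auto).
      assert (0 < e ^ 2 * L ^ 2) by (apply Rmult_lt_0_compat; auto). lra. }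
    rewrite Eg, Ze; ring. }
  exists (scal (/ L) X), (scal (/ m) Y), th, m.
  split; [|split; [exact Hm|]].
  - split; [|split]; rewrite ip_scal_l, ip_scal_r.
    + rewrite EX; field; lra.
    + rewrite EY; field; lra.
    + rewrite O; ring.
  - split; apply ip_ext; intros h; rewrite !ip_scal_l; [fold X|fold Y]; field; lra.
Qed.

(** For a competitor with singular values [L >= m >= L / K] the duality bound reads
    [L + tau m <= 2 J(tau) = alpha (1 + tau / K)]. *)
Lemma stretch_le (K tau : R) (F : C -> H) (L : R) :
  1 <= K -> 0 < tau <= 1 -> alpha tau = K * beta tau ->
  admissible K F -> is_max_stretch0 F L ->
  L <= alpha tau /\
  (L = alpha tau -> exists (u1 u2 : H) (th : R), orthonormal_pair ip u1 u2 /\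
     forall z, disk z -> F z = Fext u1 u2 tau (rot th z)).
Proof.
  intros HK Ht E (HF & F0 & (L' & l & HL' & Hl & Hl0 & HlL & HLK)) HL.
  rewrite (is_max_stretch0_unique F L' L HL' HL) in HlL, HLK; clear L' HL'.
  destruct HF as [Hh Hb].
  pose proof Hh as (Fx & Fy & _ & _ & _ & _ & H1 & _).
  assert (Z : disk (RtoC 0)) by (apply disk_iff; simpl; lra).
  destruct (H1 _ Z) as (DA & DB & _); simpl in DA, DB.
  set (A := Fx (RtoC 0)) in *; set (B := Fy (RtoC 0)) in *.
  destruct HL as (dF & D & (v & Hv & Ev) & Hmax).
  destruct Hl as (dF' & D' & _ & Hmin).
  assert (ED : forall w, dF w = diff0 A B w)
    by (intros; now apply (filterdiff0_diff0 F dF)).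
  assert (ED' : forall w, dF' w = diff0 A B w)
    by (intros; now apply (filterdiff0_diff0 F dF')).
  rewrite ED in Ev.
  destruct (singular_vectors A B L l v Hv Ev) as (u1 & u2 & th & m & O & Hm & E1 & E2); auto.
  { intros w Hw; rewrite <- ED; auto. }
  { intros w Hw; rewrite <- ED'; auto. }
  pose proof (pairing0_le F A B u1 u2 tau th (conj Hh Hb) O DA DB) as P.
  assert (EP : pairing0 A B u1 u2 tau th = L + tau * m).
  { unfold pairing0; rewrite E1, E2, !ip_scal_l.
    destruct O as (O1 & O2 & _); rewrite O1, O2; ring. }
  assert (HmK : L <= K * m) by nra.
  assert (E2J : 2 * J tau = alpha tau + tau * (alpha tau / K)).
  { rewrite <- alpha_tau_beta by lra.
    replace (alpha tau / K) with (beta tau) by (rewrite E; field; lra). ring. }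
  assert (HmK' : L / K <= m) by (apply (Rle_div_l _ _ K); lra).
  assert (HtK : 0 < tau / K) by (apply Rdiv_lt_0_compat; lra).
  assert (Q : tau * (L / K) <= tau * m) by (apply Rmult_le_compat_l; lra).
  split.
  - apply Rmult_le_reg_r with (1 + tau / K); [lra|].
    replace (L * (1 + tau / K)) with (L + tau * (L / K)) by (field; lra).
    replace (alpha tau * (1 + tau / K)) with (alpha tau + tau * (alpha tau / K)) by (field; lra).
    lra.
  - intros EL; exists u1, u2, th; split; [exact O|].
    apply (harmonic_rigidity F A B); auto; [split; assumption|].
    apply Rle_antisym; [exact P|]. rewrite EP, E2J, <- EL; lra.
Qed.

(** * Orthogonal transformations *)

Definition reflect (n x : H) : H := minus x (scal (2 * ip x n / ip n n) n).

Lemma ip_reflect (n x y : H) : ip (reflect n x) (reflect n y) = ip x y.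
Proof.
  unfold reflect; rewrite !ip_minus_l, !ip_minus_r, !ip_scal_l, !ip_scal_r.
  rewrite (ip_sym _ _ Hip n y).
  destruct (Req_dec (ip n n) 0) as [E|E].
  - rewrite (ip_self_eq_0 _ E), !ip_zero_r; unfold Rdiv; ring.
  - field; exact E.
Qed.

Lemma reflect_reflect (n x : H) : reflect n (reflect n x) = x.
Proof.
  apply ip_ext; intros h; unfold reflect.
  rewrite !ip_minus_l, !ip_scal_l.
  destruct (Req_dec (ip n n) 0) as [E|E].
  - rewrite (ip_self_eq_0 _ E), !ip_zero_l; unfold Rdiv; ring.
  - field; exact E.
Qed.

Lemma norm_reflect (n x : H) : norm (reflect n x) = norm x.
Proof. apply norm_eq_sqrt; [apply norm_ge_0|]. rewrite ip_reflect; apply ip_self. Qed.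

Lemma reflect_orthogonal (n : H) : orthogonal (reflect n).
Proof.
  split; [|split].
  - constructor.
    + intros x y; apply ip_ext; intros h; unfold reflect.
      rewrite !ip_plus_l, !ip_minus_l, !ip_scal_l, !ip_plus_l; unfold Rdiv; ring.
    + intros k x; apply ip_ext; intros h; unfold reflect.
      rewrite !ip_scal_l, !ip_minus_l, !ip_scal_l; unfold Rdiv; ring.
    + exists 1; split; [lra|]. intros x; rewrite norm_reflect; lra.
  - apply norm_reflect.
  - intros y; exists (reflect n y); apply reflect_reflect.
Qed.

Lemma reflect_swap (x y : H) : ip x x = ip y y -> reflect (minus x y) x = y.
Proof.
  intros E; apply ip_ext; intros h; unfold reflect.
  destruct (Req_dec (ip (minus x y) (minus x y)) 0) as [Z|Z].
  - pose proof (ip_self_eq_0 _ Z) as Z'.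
    assert (E' : ip x h = ip y h).
    { generalize (ip_minus_l x y h); rewrite Z', ip_zero_l; lra. }
    rewrite ip_minus_l, ip_scal_l, Z', !ip_zero_l, E'; ring.
  - assert (k1 : 2 * ip x (minus x y) / ip (minus x y) (minus x y) = 1).
    { rewrite ip_minus_l, !ip_minus_r, (ip_sym _ _ Hip y x), <- E in Z |- *.
      field; lra. }
    rewrite k1, ip_minus_l, ip_scal_l, ip_minus_l; ring.
Qed.

Lemma reflect_fix (n x : H) : ip x n = 0 -> reflect n x = x.
Proof.
  intros E; apply ip_ext; intros h; unfold reflect; rewrite ip_minus_l, ip_scal_l, E.
  unfold Rdiv; ring.
Qed.

Lemma orthogonal_comp (U V : H -> H) : orthogonal U -> orthogonal V ->
  orthogonal (fun x => U (V x)).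
Proof.
  intros (U1 & U2 & U3) (V1 & V2 & V3); split; [|split].
  - now apply (is_linear_comp V U).
  - intros x; now rewrite U2, V2.
  - intros y; destruct (U3 y) as [x Ex]; destruct (V3 x) as [w Ew]; exists w; now rewrite Ew.
Qed.

(** A first reflection takes [e1] to [u1]; a second one, in a hyperplane through
    [u1], takes the image of [e2] to [u2]. *)
Lemma orthogonal_extension (e1 e2 u1 u2 : H) :
  orthonormal_pair ip e1 e2 -> orthonormal_pair ip u1 u2 ->
  exists U : H -> H, orthogonal U /\ U e1 = u1 /\ U e2 = u2.
Proof.
  intros (P1 & P2 & P3) (O1 & O2 & O3).
  set (n := minus e1 u1); set (f := reflect n e2); set (n' := minus f u2).
  assert (E1 : reflect n e1 = u1) by (apply reflect_swap; lra).
  assert (Ef : ip f f = 1) by (unfold f; now rewrite ip_reflect).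
  assert (Eu : ip u1 f = 0) by (rewrite <- E1; unfold f; now rewrite ip_reflect).
  exists (fun x => reflect n' (reflect n x)).
  split; [apply (orthogonal_comp (reflect n') (reflect n)); apply reflect_orthogonal|].
  split.
  - rewrite E1; apply reflect_fix; unfold n'; rewrite ip_minus_r; lra.
  - apply (reflect_swap f u2); rewrite Ef, O2; reflexivity.
Qed.

Lemma norm_C_R (z : C) : norm (z : C_R_NormedModule) = Cmod z.
Proof.
  change (sqrt (Rabs (fst z) ^ 2 + Rabs (snd z) ^ 2) = Cmod z).
  now rewrite !pow2_abs.
Qed.

Lemma rot_rot (th : R) (z : C) : rot th (rot (- th) z) = z.
Proof.
  destruct z as [x y]; unfold rot; simpl; rewrite cos_neg, sin_neg.
  pose proof (cos2_sin2 th) as E; f_equal.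
  - transitivity ((cos th ^ 2 + sin th ^ 2) * x); [ring|rewrite E; ring].
  - transitivity ((cos th ^ 2 + sin th ^ 2) * y); [ring|rewrite E; ring].
Qed.

Lemma rot_orthogonal (th : R) : orthogonal (V := C_R_NormedModule) (rot th).
Proof.
  split; [|split].
  - constructor.
    + intros [x y] [x' y'].
      change (rot th (x + x', y + y') =
        (fst (rot th (x, y)) + fst (rot th (x', y')), snd (rot th (x, y)) + snd (rot th (x', y')))).
      unfold rot; simpl; f_equal; ring.
    + intros k [x y].
      change (rot th (k * x, k * y) = (k * fst (rot th (x, y)), k * snd (rot th (x, y)))).
      unfold rot; simpl; f_equal; ring.
    + exists 1; split; [lra|]. intros x; rewrite !norm_C_R, Cmod_rot; lra.
  - intros x; now rewrite !norm_C_R, Cmod_rot.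
  - intros y; exists (rot (- th) y); apply rot_rot.
Qed.

Lemma Fext_image (U : H -> H) (e1 e2 : H) (tau : R) (z : C) :
  orthogonal U -> 0 < tau -> disk z ->
  U (Fext e1 e2 tau z) = Fext (U e1) (U e2) tau z.
Proof.
  intros (U1 & _ & _) Ht Hz; rewrite !Fext_poissonV by auto; unfold poissonV.
  now rewrite (linear_plus _ U1), !(linear_scal _ U1).
Qed.

(** [T] permutes the unit vectors of the plane and [U] preserves norms. *)
Lemma max_stretch_composition (F G : C -> H) (U : H -> H) (T : C -> C) (L L' : R) :
  orthogonal U -> orthogonal (V := C_R_NormedModule) T ->
  (forall z, disk z -> F z = U (G (T z))) ->
  is_max_stretch0 F L -> is_max_stretch0 G L' -> L = L'.
Proof.
  intros (U1 & U2 & U3) (T1 & T2 & T3) E HL (dG & DG & (v & Hv & Ev) & Mv).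
  apply (is_max_stretch0_unique F); [exact HL|].
  assert (T2' : forall z, Cmod (T z) = Cmod z) by (intros z; rewrite <- !norm_C_R; apply T2).
  assert (T0 : T (RtoC 0) = RtoC 0).
  { apply Cmod_eq_0; rewrite T2'; apply Cmod_0. }
  exists (fun w => U (dG (T w))); split; [|split].
  - apply (filterdiff0_ext (fun z => U (G (T z)))); [intros; symmetry; auto|].
    assert (D0 : filterdiff (U := C_R_NormedModule) G (locally (T (RtoC 0))) dG)
      by now rewrite T0.
    pose proof (filterdiff_comp' (U := C_R_NormedModule) (V := C_R_NormedModule) (W := H)
      T G (RtoC 0) _ _ (filterdiff_linear _ T1) D0) as D1.
    exact (filterdiff_comp' (U := C_R_NormedModule) (V := H) (W := H)
      _ U (RtoC 0) _ _ D1 (filterdiff_linear _ U1)).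
  - destruct (T3 v) as [w Ew]; exists w; split.
    + now rewrite <- T2', Ew.
    + now rewrite U2, Ew.
  - intros w Hw; rewrite U2; apply Mv; now rewrite T2'.
Qed.
End Hilbert.

(** * The extremal problem *)

Lemma critical_unique (K tau s : R) : 1 <= K -> 0 < tau <= 1 -> 0 < s <= 1 ->
  alpha tau = K * beta tau -> alpha s = K * beta s -> s = tau.
Proof.
  intros HK Ht Hs Et Es.
  destruct (Req_dec s tau) as [|N]; [auto|exfalso].
  pose proof (stretch_bound_strict K tau s HK Ht Et (proj1 Hs) N) as Q1.
  assert (N' : tau <> s) by auto.
  pose proof (stretch_bound_strict K s tau HK Hs Es (proj1 Ht) N') as Q2.
  rewrite (stretch_bound_critical K s) in Q1 by auto.
  rewrite (stretch_bound_critical K tau) in Q2 by auto. lra.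
Qed.

Lemma stretch_bound_ge (K tau s : R) : 1 <= K -> 0 < tau <= 1 ->
  alpha tau = K * beta tau -> 0 < s -> alpha tau <= stretch_bound K s.
Proof.
  intros HK Ht E Hs; destruct (Req_dec s tau) as [->|N].
  - rewrite stretch_bound_critical by auto; lra.
  - now apply Rlt_le, stretch_bound_strict.
Qed.

Lemma extremal_stretch_critical (H : CompleteNormedModule R_AbsRing) (ip : H -> H -> R)
    (Hip : is_inner_product H ip) (e1 e2 : H) (He : orthonormal_pair ip e1 e2)
    (K tau : R) : 1 <= K -> 0 < tau <= 1 -> alpha tau = K * beta tau ->
  extremal_stretch H K = Finite (alpha tau).
Proof.
  intros HK Ht E; apply is_lub_Rbar_unique; split.
  - intros L (F & HF & HL); exact (proj1 (stretch_le H ip Hip K tau F L HK Ht E HF HL)).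
  - intros b Hb; apply Hb; exists (Fext e1 e2 tau); split.
    + apply (Fext_admissible H ip Hip); auto; lra.
    + now apply (Fext_max_stretch H ip Hip).
Qed.

Theorem theorem8p1 (H : CompleteNormedModule R_AbsRing) (ip : H -> H -> R)
    (Hip : is_inner_product H ip) (e1 e2 : H)
    (He : orthonormal_pair ip e1 e2) :
  (forall tau : R, 0 < tau <= 1 ->
     harmonic_disk_to_ball (Fext e1 e2 tau) /\
     Fext e1 e2 tau (RtoC 0) = zero /\
     is_derive (fun x : R => Fext e1 e2 tau (x, 0)) 0 (scal (alpha tau) e1) /\
     is_derive (fun y : R => Fext e1 e2 tau (0, y)) 0 (scal (beta tau) e2) /\
     0 < alpha tau /\ 0 < beta tau /\ beta tau <= alpha tau) /\
  (forall K : R, 1 <= K ->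
     extremal_stretch H K
       = Glb_Rbar (fun b : R => exists tau : R, 0 < tau <= 1 /\ b = stretch_bound K tau) /\
     exists tauK : R,
       (forall tau : R, minimizes_stretch_bound K tau <-> tau = tauK) /\
       (K = 1 -> tauK = 1) /\
       (1 < K ->
          0 < tauK < 1 /\
          forall tau : R, 0 < tau <= 1 ->
            (alpha tau / beta tau = K <-> tau = tauK)) /\
       extremal_stretch H K = Finite (alpha tauK) /\
       admissible K (Fext e1 e2 tauK) /\
       is_max_stretch0 (Fext e1 e2 tauK) (alpha tauK) /\
       forall (F : C -> H) (L : R),
         admissible K F -> is_max_stretch0 F L ->
         (Finite L = extremal_stretch H K <->
          exists (U : H -> H) (T : C -> C),
            orthogonal U /\ orthogonal (V := C_R_NormedModule) T /\
            forall z : C, disk z -> F z = U (Fext e1 e2 tauK (T z)))).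
Proof.
  split.
  - intros tau Ht; assert (Ht0 : 0 < tau) by lra.
    destruct (filterdiff0_axes H ip Hip _ _ _ (Fext_filterdiff0 H ip Hip e1 e2 tau Ht0)) as [DA DB].
    pose proof (alpha_ge_1 tau Ht); pose proof (beta_ge tau Ht); pose proof (beta_le_alpha tau Ht).
    split; [now apply (Fext_disk_to_ball H ip Hip)|].
    split; [now apply (Fext_0 H ip Hip)|].
    split; [exact DA|split; [exact DB|]]. lra.
  - intros K HK.
    destruct (exists_critical K HK) as [tau [Ht E]].
    pose proof (extremal_stretch_critical H ip Hip e1 e2 He K tau HK Ht E) as EM.
    pose proof (stretch_bound_critical K tau HK Ht E) as Eb.
    split.
    { rewrite EM; symmetry; apply is_glb_Rbar_unique; split.
      - intros b (s & Hs & ->); simpl; apply stretch_bound_ge; auto; lra.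
      - intros b Hb; apply Hb; exists tau; auto. }
    exists tau; split; [|split; [|split; [|split; [|split; [|split]]]]].
    + intros s; split.
      * intros [Hs Hmin]; destruct (Req_dec s tau) as [|N]; [auto|exfalso].
        pose proof (stretch_bound_strict K tau s HK Ht E (proj1 Hs) N).
        pose proof (Hmin tau Ht); lra.
      * intros ->; split; [exact Ht|].
        intros s Hs; rewrite Eb; apply stretch_bound_ge; auto; lra.
    + intros K1; symmetry; apply (critical_unique K); auto; [lra|].
      rewrite K1, alpha_1_eq_beta_1; ring.
    + intros HK1; split.
      * destruct (Req_dec tau 1) as [E1|]; [exfalso|lra].
        pose proof (beta_ge tau Ht). rewrite E1, alpha_1_eq_beta_1 in E. rewrite E1 in *. nra.
      * intros s Hs; pose proof (beta_ge s Hs); split.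
        -- intros Es; apply (critical_unique K); auto.
           rewrite <- Es; field; lra.
        -- intros ->; rewrite E; field; lra.
    + exact EM.
    + apply (Fext_admissible H ip Hip); auto; lra.
    + now apply (Fext_max_stretch H ip Hip).
    + intros F L HF HL; rewrite EM; split.
      * intros EL; injection EL as EL.
        destruct (proj2 (stretch_le H ip Hip K tau F L HK Ht E HF HL) EL)
          as (u1 & u2 & th & O & EF).
        destruct (orthogonal_extension H ip Hip e1 e2 u1 u2 He O) as (U & HU & U1 & U2).
        exists U, (rot th); split; [exact HU|split; [apply rot_orthogonal|]].
        intros z Hz; rewrite EF by exact Hz.
        assert (Hz' : disk (rot th z)) by (unfold disk; now rewrite Cmod_rot).
        rewrite (Fext_image H ip Hip) by (auto; lra). now rewrite U1, U2.
      * intros (U & T & HU & HT & EF); f_equal.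
        apply (max_stretch_composition H ip Hip F (Fext e1 e2 tau) U T); auto.
        now apply (Fext_max_stretch H ip Hip).
Qed.
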